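(* Let $d\in\mathbb N$. For each $\alpha>1$ and each $x_0\in\mathbf X$, there exist a norm $\nu=\nu(\alpha,x_0)$ on $\mathbb R^d$ and $\theta\in(0,\pi)$ such that the following is true. Let $$\mathcal C=\left\{z\in\mathbb R^d\setminus\{0\}:\ \left\langle \frac{z}{|z|},\frac{x_0}{|x_0|}\right\rangle>\cos(\theta/2)\right\}$$ be the Euclidean cone based at $0$ with opening angle $\theta$ centered at the ray from $0$ through $x_0$. Let $f(z)=\nu(z)^\alpha$ and let $\{A_t\}_{t\ge0}$ be the $f$-weighted FPP clusters, with $\tau_\infty$ the first time at which the cluster is infinite. Then almost surely either $$\#\left(\mathcal V(A_{\tau_\infty})\setminus\mathcal C\right)<\infty\quad\text{or}\quad \#\left(\mathcal V(A_{\tau_\infty})\setminus(-\mathcal C)\right)<\infty .$$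
   Context: $f$-weighted FPP: consider $\mathbb Z^d$ with nearest-neighbour edges. For each edge $e$ with midpoint $m_e$ let $X_e$ be an exponential random variable with parameter (rate) $f(m_e)$, all independent. For a path $\eta$ (a sequence of consecutive edges) let $T(\eta)=\sum_{e\in\eta}X_e$, and let $T(u,v)$ be the infimum of $T(\eta)$ over paths from $u$ to $v$. $A_t$ is the subgraph with vertex set $\mathcal V(A_t)=\{v: T(0,v)\le t\}$ and edge set $\mathcal E(A_t)$ the set of edges lying on some path $\eta$ whose first edge is incident to $0$ and with $T(\eta)\le t$. $\tau_\infty=\inf\{t>0:\#\mathcal E(A_t)=\infty\}$ (a.s. finite when $\alpha>1$). Standard FPP limit shape: $\mathbf A\subset\mathbb R^d$ is the deterministic limit shape of the case $f\equiv1$ (i.i.d. rate-1 exponential passage times), i.e. the compact convex set, symmetric about $0$, such that, with $A_s^F=\{v+z:v\in\mathcal V(A_s),z\in[-1/2,1/2]^d\}$ for the rate-1 clusters, $\lim_{t\to\infty}\mathbb P[(1-\epsilon)\mathbf A\subset s^{-1}A_s^F\subset(1+\epsilon)\mathbf A\ \forall s\ge t]=1$ for each $\epsilon>0$. $\mu$ is the norm with closed unit ball $\mathbf A$, $|\cdot|$ is the Euclidean norm, $\overline\rho=\sup_{z\ne0}|z|/\mu(z)$, and $\mathbf X=\{x\in\partial\mathbf A: |x|=\overline\rho\}$ is the set of points of $\partial\mathbf A$ furthest from $0$. *)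

(* Defs.v *)
From mathcomp Require Import all_boot all_order all_algebra.
From mathcomp Require Import all_classical all_reals all_analysis.

Set Implicit Arguments.
Unset Strict Implicit.
Unset Printing Implicit Defensive.
Import Order.TTheory GRing.Theory Num.Theory.
Import numFieldNormedType.Exports.
Local Open Scope classical_set_scope.
Local Open Scope ring_scope.

(* The unoriented nearest-neighbour edge {v, v + e_i} of Z^d is encoded, uniquely,
   as the pair (v, i). *)
Definition edge (d : nat) : Type := ('rV[int]_d * 'I_d)%type.

Section Lattice.
Variable d : nat.

Definition edge_src (e : edge d) : 'rV[int]_d := e.1.
Definition edge_tgt (e : edge d) : 'rV[int]_d := e.1 + delta_mx 0 e.2.

Definition incident (v : 'rV[int]_d) (e : edge d) : bool :=
  (v == edge_src e) || (v == edge_tgt e).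

(* [is_path u s v]: the edges of [s] can be crossed consecutively, each in either
   direction, to go from [u] to [v]; repetitions are allowed. *)
Fixpoint is_path (u : 'rV[int]_d) (s : seq (edge d)) (v : 'rV[int]_d) : bool :=
  if s is e :: s' then
    ((u == edge_src e) && is_path (edge_tgt e) s' v) ||
    ((u == edge_tgt e) && is_path (edge_src e) s' v)
  else u == v.

Variable R : realType.

Definition embed (v : 'rV[int]_d) : 'rV[R]_d := map_mx intr v.

Definition midpoint (e : edge d) : 'rV[R]_d :=
  2^-1 *: (embed (edge_src e) + embed (edge_tgt e)).

End Lattice.

Section Euclidean.
Variables (R : realType) (d : nat).
Implicit Types x y z : 'rV[R]_d.

Definition dot x y : R := \sum_(i < d) x 0 i * y 0 i.

(* The library norm [`|x|] on 'rV[R]_d is the sup norm. *)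
Definition enorm x : R := Num.sqrt (dot x x).

Record is_norm (nu : 'rV[R]_d -> R) : Prop := IsNorm {
  is_normD : forall x y, nu (x + y) <= nu x + nu y ;
  is_normZ : forall (a : R) x, nu (a *: x) = `|a| * nu x ;
  is_norm_eq0 : forall x, nu x = 0 -> x = 0 }.

Definition boundary (A : set 'rV[R]_d) : set 'rV[R]_d := closure A `\` interior A.

Definition dilate (c : R) (A : set 'rV[R]_d) : set 'rV[R]_d :=
  [set c *: x | x in A].

Definition cone (x0 : 'rV[R]_d) (theta : R) : set 'rV[R]_d :=
  [set z | z != 0 /\
     cos (theta / 2) < dot ((enorm z)^-1 *: z) ((enorm x0)^-1 *: x0)].

Definition rho_bar (mu : 'rV[R]_d -> R) : R :=
  sup [set enorm z / mu z | z in [set z | z != 0]].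

Definition furthest (A : set 'rV[R]_d) (mu : 'rV[R]_d -> R) : set 'rV[R]_d :=
  [set x | boundary A x /\ enorm x = rho_bar mu].

End Euclidean.

Section Clusters.
Variables (R : realType) (d : nat) (W : edge d -> R).
Local Open Scope ereal_scope.

Definition path_time (s : seq (edge d)) : R := (\sum_(e <- s) W e)%R.

Definition passage_time (u v : 'rV[int]_d) : \bar R :=
  ereal_inf [set (path_time s)%:E | s in [set s | is_path u s v]].

Definition cluster_vertices (t : \bar R) : set 'rV[int]_d :=
  [set v | passage_time 0%R v <= t].

Definition cluster_edges (t : \bar R) : set (edge d) :=
  [set e | exists (e0 : edge d) (s : seq (edge d)) (u v : 'rV[int]_d),
     [/\ is_path u (e0 :: s) v, incident 0%R e0, e \in e0 :: s
       & (path_time (e0 :: s))%:E <= t]].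

Definition tau_infty : \bar R :=
  ereal_inf [set t%:E | t in
    [set t : R | (0 < t)%R /\ infinite_set (cluster_edges t%:E)]].

Definition fattened_cluster (t : \bar R) : set 'rV[R]_d :=
  [set x | exists (v : 'rV[int]_d) (z : 'rV[R]_d), [/\ cluster_vertices t v,
     (forall i : 'I_d, - 2^-1 <= z 0 i <= 2^-1)%R & x = (embed R v + z)%R]].

End Clusters.

Section Randomness.
Variables (R : realType) (disp : measure_display) (Omega : measurableType disp).
Variable P : probability Omega R.

Definition mutually_independent (I : eqType) (X : I -> {RV P >-> R}) : Prop :=
  forall (J : seq I) (B : I -> set R), uniq J ->
    (forall i, measurable (B i)) ->
    P (\bigcap_(i in [set` J]) (X i @^-1` B i)) =
    (\prod_(i <- J) P (X i @^-1` B i))%E.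

Definition has_exponential_law (X : {RV P >-> R}) (rate : R) : Prop :=
  forall B : set R, measurable B -> distribution P X B = exponential_prob rate B.

Definition weighted_fpp (d : nat) (f : 'rV[R]_d -> R)
    (X : edge d -> {RV P >-> R}) : Prop :=
  mutually_independent X /\
  forall e, has_exponential_law (X e) (f (midpoint R e)).

End Randomness.

(* The law of the passage times is determined, so the choice of the probability
   space is immaterial. The range of eps is (0, 1): since A is symmetric,
   (1 - eps) A is an enlargement of A for eps > 2. *)
Definition is_limit_shape (R : realType) (d : nat) (A : set 'rV[R]_d) : Prop :=
  [/\ compact A,
      convex_set (A : set (convex_lmodType 'rV[R]_d)),
      (forall x, A x -> A (- x)) &
      exists (disp : measure_display) (Omega : measurableType disp)
             (P : probability Omega R) (X : edge d -> {RV P >-> R}),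
        weighted_fpp (fun=> 1) X /\
        forall eps : R, 0 < eps < 1 ->
          P [set w | forall s : R, t <= s ->
               dilate (1 - eps) A
                 `<=` dilate s^-1 (fattened_cluster (X ^~ w) s%:E) /\
               dilate s^-1 (fattened_cluster (X ^~ w) s%:E)
                 `<=` dilate (1 + eps) A]
          @[t --> +oo] --> 1%E].

(* Main.v *)
Require Import Defs.
From mathcomp Require Import all_boot all_order all_algebra.
From mathcomp Require Import all_classical all_reals all_analysis.
From mathcomp Require Import measurable_realfun.
From mathcomp Require Import zify ring lra.

Set Implicit Arguments.
Unset Strict Implicit.
Unset Printing Implicit Defensive.
Import Order.TTheory GRing.Theory Num.Theory.
Import numFieldNormedType.Exports.
Local Open Scope classical_set_scope.
Local Open Scope ring_scope.

(** The point [x0] is nonzero, because [0] is interior to the unit ball of a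
norm. Let [c] be [x0], scaled to have a largest coordinate equal to [1] in
absolute value; the norm is [weight z = |<z, c>| + delta * |z|_1] for a small
[delta], and the cone is so wide that it contains the points with [<z, c> >
delta * |z|_1]. The remaining points, up to the symmetric cone, form the slow
region [|<z, c>| <= delta * |z|_1], a thin neighbourhood of a hyperplane in
which the passage times are very long.

Rough linear bounds on passage times suffice. A path of length [n] that starts
at distance [O(n)] from the origin has a cost between [time_lo * n] and
[time_hi * n] once each edge time is rescaled by its rate, with constants that
depend on [d] only ([linear_times]): a union bound over paths, in which the
exponential tails are handled through integer counts ([count_tail]).

Two consequences follow. From a vertex of weight [w] a coordinate ray leads to
infinity in a time of order [w ^ (1 - alpha)] ([ray_cost]), because [alpha > 1]
makes the costs of its dyadic blocks summable. And the cluster at the explosion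
time [tau] contains only finitely many vertices of the slow region
([slow_not_reached]): along a geodesic to a slow vertex at distance [r] there
is always an earlier vertex from which infinity is closer than the end of the
geodesic, either because its weight is much larger than [delta * r], or because
the geodesic has long remained in the slow region, which is more expensive than
leaving it sideways.

So the cluster is, up to finitely many vertices, contained in the union of two
opposite regions between which no edge passes far from the origin. If it were
infinite in both, explosion would occur at the same time [tau] along two
families of self-avoiding paths that branch at some vertex
([cluster_one_sided]). The explosion time of the first family is the time of
its first edge after the branching plus an independent quantity, and the
explosion time of the second does not involve that edge; as an exponential law
has no atom, the two almost surely differ ([no_tie],
[no_simultaneous_explosion]). *)

(** * Walks and self-avoiding paths on the lattice *)

Section Walks.
Context {d : nat}.
Implicit Types (u v x : 'rV[int]_d) (e : edge d) (s p : seq (edge d)).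

Definition other e x : 'rV[int]_d :=
  if x == edge_src e then edge_tgt e else edge_src e.

Fixpoint walk u s : bool :=
  if s is e :: s' then incident u e && walk (other e u) s' else true.

Definition endp u s : 'rV[int]_d := foldl (fun x e => other e x) u s.

Definition trace u s : seq 'rV[int]_d := scanl (fun x e => other e x) u s.

Definition simple u s : bool := walk u s && uniq (u :: trace u s).

Lemma src_neq_tgt e : edge_src e != edge_tgt e.
Proof.
rewrite /edge_tgt -subr_eq0 opprD addNKr oppr_eq0; apply/eqP => /rowP/(_ e.2).
by rewrite !mxE !eqxx.
Qed.

Lemma is_pathE u s v : is_path u s v = walk u s && (endp u s == v).
Proof.
elim: s u => [|e s IHs] u //=; rewrite !IHs /incident /other.
have := src_neq_tgt e.
case: (eqVneq u (edge_src e)) => [->|_] /= => [/negPf ->|_].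
  by rewrite orbF.
by rewrite andbA.
Qed.

Lemma walk_cat u s1 s2 :
  walk u (s1 ++ s2) = walk u s1 && walk (endp u s1) s2.
Proof. by elim: s1 u => //= e s1 IH u; rewrite IH andbA. Qed.

Lemma endp_cat u s1 s2 : endp u (s1 ++ s2) = endp (endp u s1) s2.
Proof. exact: foldl_cat. Qed.

Lemma endp_rcons u s e : endp u (rcons s e) = other e (endp u s).
Proof. by rewrite -cats1 endp_cat. Qed.

Lemma trace_cat u s1 s2 :
  trace u (s1 ++ s2) = trace u s1 ++ trace (endp u s1) s2.
Proof. exact: scanl_cat. Qed.

Lemma last_trace u s : last u (trace u s) = endp u s.
Proof. by elim: s u => //= e s IH u; rewrite IH. Qed.

Lemma mem_endp u s : endp u s \in u :: trace u s.
Proof. by rewrite -last_trace mem_last. Qed.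

Lemma incident_other e x : incident x e -> incident (other e x) e.
Proof.
by rewrite /incident /other; case: (x == edge_src e); rewrite eqxx ?orbT.
Qed.

Lemma incidentE e x y :
  incident x e -> incident y e -> y = x \/ y = other e x.
Proof.
rewrite /incident /other.
have /negPf ts := src_neq_tgt e; rewrite eq_sym in ts.
move=> /orP[]/eqP -> /orP[]/eqP ->; rewrite ?eqxx ?ts.
- by left.
- by right.
- by right.
- by left.
Qed.

Lemma mem_trace u s x :
  x \in u :: trace u s -> exists s1 s2, s = s1 ++ s2 /\ endp u s1 = x.
Proof.
elim: s u => [|e s IH] u /=.
  by rewrite inE => /eqP ->; exists [::], [::].
rewrite inE => /orP[/eqP ->|]; first by exists [::], (e :: s).
by move=> /IH[s1 [s2 [-> <-]]]; exists (e :: s1), s2.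
Qed.

Lemma simple_catl u s1 s2 : simple u (s1 ++ s2) -> simple u s1.
Proof.
rewrite /simple walk_cat trace_cat -cat_cons cat_uniq.
by move=> /andP[/andP[-> _] /andP[-> _]].
Qed.

Lemma simple_catr u s1 s2 : simple u (s1 ++ s2) -> simple (endp u s1) s2.
Proof.
rewrite /simple walk_cat trace_cat => /andP[/andP[_ ->]] /=.
rewrite cat_uniq mem_cat negb_or => /andP[/andP[us1 us2] /and3P[U1 H U2]].
rewrite U2 andbT; have := mem_endp u s1; rewrite inE => /orP[/eqP E|in1].
  by rewrite E in us2 *.
by apply/negP => in2; case/negP: H; apply/hasP; exists (endp u s1).
Qed.

Lemma walk_incident_trace u s e y :
  walk u s -> e \in s -> incident y e -> y \in u :: trace u s.
Proof.
elim: s u => //= f s IH u /andP[uf ws]; rewrite inE => /orP[/eqP ->|es] yf.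
  have [->|->] := incidentE uf yf; first by rewrite mem_head.
  by rewrite inE mem_head orbT.
by rewrite inE IH ?orbT.
Qed.

(** A path through distinct vertices never crosses an edge twice, because the
second crossing would revisit both ends of the edge. *)
Lemma simple_uniq u s : simple u s -> uniq s.
Proof.
elim: s u => //= e s IH u sus.
have := simple_catr (s1 := [:: e]) sus => /= /IH ->; rewrite andbT.
move: sus => /= /andP[/= /andP[ue ws] /andP[H _]].
by apply: contra H => es; exact: walk_incident_trace ws es ue.
Qed.

(** Loop erasure: cutting out the closed part between two visits to a vertex
only removes edges. *)
Lemma simple_subseq u s : walk u s ->
  exists s', [/\ simple u s', endp u s' = endp u s & subseq s' s].
Proof.
elim: s u => [|e s IH] u /=; first by exists [::].
move=> /andP[ue /IH[s' [ss' es' sub]]].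
have [uin|unin] := boolP (u \in other e u :: trace (other e u) s').
- have [a [b [sE ea]]] := mem_trace uin; exists b.
  rewrite -es' sE endp_cat ea; split=> //.
    by rewrite sE in ss'; have := simple_catr ss'; rewrite ea.
  by apply: subseq_trans (subseq_cons _ _); apply: subseq_trans sub;
    rewrite sE suffix_subseq.
- exists (e :: s'); rewrite /= eqxx; split=> //.
  by move: ss' => /andP[w U]; rewrite /simple /= ue w /= unin.
Qed.

Definition steps u : seq (edge d) :=
  [seq (u, i) | i <- enum 'I_d] ++ [seq (u - delta_mx 0 i, i) | i <- enum 'I_d].

Lemma mem_steps u e : (e \in steps u) = incident u e.
Proof.
case: e => w i; rewrite mem_cat /incident /edge_src /edge_tgt /=; congr orb.
  apply/mapP/eqP => [[j _ [-> _]] //|->]; by exists i; rewrite ?mem_enum.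
apply/mapP/eqP => [[j _ [-> ->]]|->]; first by rewrite subrK.
by exists i; rewrite ?mem_enum // addrK.
Qed.

Lemma size_steps u : size (steps u) = d.*2.
Proof.
have E (f : 'I_d -> edge d) : size (map f (enum 'I_d)) = d.
  by rewrite size_map size_enum_ord.
by rewrite size_cat !E addnn.
Qed.

Fixpoint walks u n : seq (seq (edge d)) :=
  if n is n'.+1 then
    flatten [seq [seq e :: s | s <- walks (other e u) n'] | e <- steps u]
  else [:: [::]].

Lemma mem_walks u n s : (s \in walks u n) = walk u s && (size s == n).
Proof.
elim: n u s => [|n IH] u s /=.
  by rewrite inE size_eq0; case: eqP => [->|]; rewrite ?andbF.
apply/flattenP/idP => [[l /mapP[e + ->] /mapP[s' + ->]]|].
  by rewrite mem_steps IH => /= -> /andP[-> /eqP ->]; rewrite eqxx.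
case: s => [//|e s] /= /andP[/andP[ue ws] sn].
exists [seq e :: s | s <- walks (other e u) n].
  by apply/mapP; exists e; rewrite ?mem_steps.
by apply/mapP; exists s; rewrite ?IH ?ws.
Qed.

Lemma size_walks u n : size (walks u n) = (d.*2 ^ n)%N.
Proof.
elim: n u => [|n IH] u //=; rewrite size_flatten /shape -map_comp sumnE.
rewrite big_map (eq_bigr (fun=> (d.*2 ^ n)%N)) => [|e _].
  by rewrite big_const_seq iter_addn_0 count_predT size_steps expnS mulnC.
by rewrite /= size_map IH.
Qed.

Definition nrm1 v : nat := \sum_(i < d) absz (v 0%R i).

Definition box (B : nat) : seq 'rV[int]_d :=
  [seq (\row_i ((g i : nat)%:Z - B%:Z)) | g : {ffun 'I_d -> 'I_(B.*2.+1)}].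

Lemma mem_box v B : (nrm1 v <= B)%N -> v \in box B.
Proof.
move=> vB; have vi i : (absz (v 0%R i) <= B)%N.
  by apply: leq_trans vB; rewrite /nrm1 (bigD1 i) //= leq_addr.
apply/mapP; exists [ffun i => inord (absz (v 0 i + B%:Z))].
  by rewrite mem_enum.
apply/rowP => i; rewrite mxE ffunE inordK; have := vi i; move: (v 0 i) => z; lia.
Qed.

Lemma size_box B : size (box B) = (B.*2.+1 ^ d)%N.
Proof. by rewrite size_map -cardE card_ffun !card_ord. Qed.

Lemma finite_nrm1 B : finite_set [set v | (nrm1 v <= B)%N].
Proof.
apply: (@sub_finite_set _ _ [set` box B]) => [v /=|]; first exact: mem_box.
exact: finite_seq.
Qed.

Lemma nrm1_other u e : incident u e -> (nrm1 (other e u) <= (nrm1 u).+1)%N.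
Proof.
move=> ue; have [i Hi] : exists i, forall j, j != i -> other e u 0 j = u 0 j.
  exists e.2 => j ji; move: ue; rewrite /incident /other.
  have E : edge_tgt e 0 j = edge_src e 0 j.
    by rewrite /edge_tgt /edge_src !mxE eqxx (negPf ji) addr0.
  by case: (eqVneq u (edge_src e)) => [-> //|_] /= /eqP ->.
have Hi' : (absz (other e u 0%R i) <= (absz (u 0%R i)).+1)%N.
  move: ue; rewrite /incident /other; case: e {Hi} => w k.
  rewrite /edge_tgt /edge_src /=.
  case: (eqVneq u w) => [->|_] /= => [_|/eqP ->];
    rewrite !mxE eqxx /=; case: (i == k); rewrite ?mulr1n ?mulr0n;
    move: (w 0 i) => z; lia.
rewrite /nrm1 (bigD1 i) //= [X in (_ <= X.+1)%N](bigD1 i) //=.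
by rewrite -addSn leq_add // leq_sum // => j ji; rewrite Hi.
Qed.

Lemma nrm10 : nrm1 0 = 0%N.
Proof. by rewrite /nrm1 big1 // => i _; rewrite mxE. Qed.

Lemma nrm1_endp u s : walk u s -> (nrm1 (endp u s) <= nrm1 u + size s)%N.
Proof.
elim: s u => [|e s IH] u /=; first by rewrite addn0.
move=> /andP[ue /IH/leq_trans]; apply.
by rewrite addnS -addSn leq_add2r nrm1_other.
Qed.

Lemma otherK e x : incident x e -> other e (other e x) = x.
Proof.
have := src_neq_tgt e; rewrite /incident /other => st.
case: (eqVneq x (edge_src e)) => [->|_] /= => [_|/eqP ->]; last by rewrite eqxx.
by rewrite eq_sym (negPf st).
Qed.

Lemma nrm1_start u s : walk u s -> (nrm1 u <= nrm1 (endp u s) + size s)%N.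
Proof.
elim: s u => [|e s IH] u /=; first by rewrite addn0.
move=> /andP[ue /IH H]; have := nrm1_other (incident_other ue).
by rewrite otherK // addnS => /leq_trans; apply; rewrite ltnS.
Qed.

End Walks.

(** * Tails of the exponential law *)

Section ExponentialLaw.
Context {R : realType} {disp : measure_display} {Omega : measurableType disp}.
Context {P : probability Omega R} (X : {RV P >-> R}) (rate : R).
Hypotheses (rate_gt0 : 0 < rate) (lawX : has_exponential_law X rate).
Local Notation mu := (@lebesgue_measure R).

Let probE (B : set R) : measurable B ->
  P (X @^-1` B) = exponential_prob rate B.
Proof. exact: lawX. Qed.

Lemma exponential_le_length (B : set R) : measurable B ->
  (P (X @^-1` B) <= rate%:E * mu B)%E.
Proof.
move=> mB; rewrite probE // /exponential_prob.
apply: (@le_trans _ _ (\int[mu]_(x in B) rate%:E)%E); last first.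
  by rewrite integral_cst.
apply: ge0_le_integral => //.
- by move=> x _; rewrite lee_fin exponential_pdf_ge0 // ltW.
- apply/measurable_EFinP; apply: measurable_funTS.
  exact: measurable_exponential_pdf.
- move=> x _; rewrite lee_fin.
  have [x0|x0] := leP 0 x; last by rewrite lt0_exponential_pdf // ltW.
  rewrite exponential_pdfE // ler_piMr ?(ltW rate_gt0) //.
  by rewrite -expR0 ler_expR mulNr oppr_le0 mulr_ge0 // ltW.
Qed.

Lemma exponential_neg : P (X @^-1` `]-oo, 0[%classic) = 0%E.
Proof.
rewrite probE // /exponential_prob integral0_eq // => x /=; rewrite in_itv /= => x0.
by rewrite lt0_exponential_pdf.
Qed.

Let mX (B : set R) : measurable B -> measurable (X @^-1` B).
Proof. by move=> mB; rewrite -[_ @^-1` _]setTI; exact: measurable_funP. Qed.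

Lemma exponential_le (y : R) : 0 <= y ->
  (P (X @^-1` `]-oo, y]%classic) <= (rate * y)%:E)%E.
Proof.
move=> y0; rewrite (_ : `]-oo, y]%classic = `]-oo, 0[%classic `|` `[0, y]%classic).
  rewrite preimage_setU; apply: le_trans (measureU2 _ _ _) _.
  - exact: mX.
  - exact: mX.
  rewrite [X in (X + _)%E]exponential_neg add0e.
  apply: le_trans (exponential_le_length _) _ => //.
  rewrite lebesgue_measure_itv /= lte_fin; case: ltP => _.
    by rewrite sube0.
  by rewrite mule0 lee_fin mulr_ge0 // ltW.
apply/seteqP; split => x /=; rewrite !in_itv /=.
  by move=> xy; have [|] := ltP x 0; [left|right].
by move=> [x0|/andP[] //]; apply: le_trans y0; exact: ltW.
Qed.

Lemma exponential_ge (y : R) : 0 < y ->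
  (P (X @^-1` `[y, +oo[%classic) <= (expR (- (rate * y)))%:E)%E.
Proof.
move=> y0; have E := exponential_prob_itv0c rate y0.
apply: (@le_trans _ _ (P (X @^-1` `]y, +oo[%classic))).
  rewrite (_ : `[y, +oo[%classic = [set y] `|` `]y, +oo[%classic).
    rewrite preimage_setU; apply: le_trans (measureU2 _ _ _) _.
    - exact: mX.
    - exact: mX.
    rewrite -[leRHS]add0e leeD2r //.
    apply: le_trans (exponential_le_length _) _ => //.
    by rewrite lebesgue_measure_set1 mule0.
  by rewrite setU1itv.
have : (P (X @^-1` (`]y, +oo[%classic `|` `[0%R, y]%classic)) <= 1)%E.
  by apply: probability_le1; apply: mX; exact: measurableU.
rewrite preimage_setU measureU; [|exact: mX|exact: mX|]; last first.
  apply/seteqP; split => // w [] /=; rewrite !in_itv /= andbT => yx /andP[_].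
  by rewrite leNgt yx.
rewrite [X in (_ + X)%E]probE // E -mulNr -EFinB -leeBrDr // -EFinB => /le_trans; apply.
by rewrite lee_fin opprB addrC subrK.
Qed.

End ExponentialLaw.

(** * Sums of independent counts *)

Section CountTail.
Context {R : realType} {disp : measure_display} {Omega : measurableType disp}.
Context {P : probability Omega R} {I : eqType} (X : I -> {RV P >-> R}).
Variable K : I -> R -> nat.
Hypothesis measurable_K : forall i k, measurable [set x | (k <= K i x)%N].

Definition count_sum (s : seq I) (w : Omega) : nat :=
  (\sum_(i <- s) K i (X i w))%N.

Let mX i (B : set R) : measurable B -> measurable (X i @^-1` B).
Proof. by move=> mB; rewrite -[_ @^-1` _]setTI; exact: measurable_funP. Qed.

Lemma count_sum_cons i s m :
  [set w | (m <= count_sum (i :: s) w)%N] =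
  \big[setU/set0]_(k < m.+1) (X i @^-1` [set x | (k <= K i x)%N] `&`
                        [set w | (m - k <= count_sum s w)%N]).
Proof.
rewrite -(bigcup_mkord _ (fun k => X i @^-1` [set x | (k <= K i x)%N] `&`
  [set w | (m - k <= count_sum s w)%N])).
apply/seteqP; split => w /=.
  rewrite /count_sum big_cons => H.
  exists (minn m (K i (X i w))) => /=; first by rewrite ltnS geq_minl.
  split; first by rewrite /= geq_minr.
  by rewrite /=; lia.
by move=> [k /= km [/= H1 H2]]; rewrite /count_sum big_cons; move: H1 H2;
  rewrite /count_sum; lia.
Qed.

Lemma measurable_count_sum s m :
  measurable [set w | (m <= count_sum s w)%N].
Proof.
elim: s m => [|i s IH] m; last first.
  rewrite count_sum_cons; apply: bigsetU_measurable => k _.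
  by apply: measurableI; [exact: mX|exact: IH].
rewrite /count_sum; case: m => [|m].
  by rewrite (_ : [set _ | _] = setT) //; apply/seteqP; split.
rewrite (_ : [set _ | _] = set0) //; apply/seteqP; split => w //=.
by rewrite big_nil.
Qed.

Hypothesis indepX : mutually_independent X.
Variable rho : R.
Hypothesis rho_ge0 : 0 <= rho.
Hypothesis tail_K : forall i k,
  (P (X i @^-1` [set x | (k <= K i x)%N]) <= (rho ^+ k)%:E)%E.

(** The induction on [s] splits according to the count of the first index of
[s], which becomes one more constraint [B] on an index of [J]. *)
Lemma count_tail_joint s (J : seq I) (B : I -> set R) m :
  uniq (s ++ J) -> (forall i, measurable (B i)) ->
  (P (\bigcap_(i in [set` J]) (X i @^-1` B i) `&`
      [set w | (m <= count_sum s w)%N]) <=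
   \prod_(i <- J) P (X i @^-1` B i) *
     (2 ^+ size s * (2 * rho) ^+ m)%:E)%E.
Proof.
have mcap (J' : seq I) (B' : I -> set R) : (forall i, measurable (B' i)) ->
    measurable (\bigcap_(i in [set` J']) (X i @^-1` B' i)).
  move=> mB; apply: fin_bigcap_measurable => [|i _]; first exact: finite_seq.
  exact: mX.
have prod_ge0 (J' : seq I) (B' : I -> set R) :
    (0 <= \prod_(i <- J') P (X i @^-1` B' i))%E.
  by apply: prode_ge0 => i _; exact: measure_ge0.
elim: s J B m => [|e s IH] J B m /= uJ mB.
  rewrite /count_sum; case: m => [|m].
    rewrite (_ : [set w | (0 <= _)%N] = setT) ?setIT ?mulr1 ?mule1; last first.
      by apply/seteqP; split.
    by rewrite indepX.
  rewrite (_ : [set w | (m < _)%N] = set0) ?setI0 ?measure0; last first.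
    by apply/seteqP; split => w //=; rewrite big_nil.
  by rewrite mule_ge0 // lee_fin mulr_ge0 // exprn_ge0 // mulr_ge0.
rewrite count_sum_cons big_distrr /=.
pose F k := \bigcap_(i in [set` J]) X i @^-1` B i `&`
   (X e @^-1` [set x | (k <= K e x)%N] `&`
                        [set w | (m - k <= count_sum s w)%N]).
have mF k : measurable (F k).
  apply: measurableI; first exact: mcap.
  by apply: measurableI; [exact: mX|exact: measurable_count_sum].
apply: le_trans (@Boole_inequality _ _ _ P F m.+1 (fun i _ => mF i)) _.
have -> : ((2 ^+ (size s).+1 * (2 * rho) ^+ m)%:E =
  (2 ^+ size s * (2 * rho) ^+ m)%:E * 2%:E)%E.
  by rewrite -EFinM exprS; congr EFin; ring.
rewrite muleA.
set c := (X in (_ <= X * 2%:E)%E).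
apply: (@le_trans _ _ (\sum_(k < m.+1) c * (2^-1 ^+ k)%:E)%E).
  apply: lee_sum => -[k /= km] _.
  pose B' i := if i == e then [set x | (k <= K e x)%N] else B i.
  have mB' i : measurable (B' i) by rewrite /B'; case: eqP.
  have uJ' : uniq (s ++ e :: J).
    by move: uJ; rewrite -cat1s uniq_catCA cat1s.
  have enJ : e \notin J.
    by move: uJ => /andP[]; rewrite mem_cat negb_or => /andP[].
  have H := IH (e :: J) B' (m - k)%N uJ' mB'.
  rewrite /F (_ : \bigcap_(i in [set` J]) X i @^-1` B i `&` _ =
    \bigcap_(i in [set` (e :: J)]) X i @^-1` B' i `&`
      [set w | (m - k <= count_sum s w)%N]); last first.
    apply/seteqP; split => w.
      move=> [HJ [He Hs]]; split=> // i /=; rewrite inE /B' => /orP[/eqP ->|iJ].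
        by rewrite eqxx.
      by case: eqP => [->//|_]; exact: HJ.
    move=> [HJ Hs]; split; last first.
      by split => //; have := HJ e; rewrite /= mem_head /B' eqxx; exact.
    move=> i iJ; have := HJ i; rewrite /= inE [i \in J]iJ orbT /B' => /(_ isT).
    by case: eqP => // ie; rewrite -ie [_ \in J]iJ in enJ.
  apply: le_trans H _; rewrite big_cons.
  rewrite (_ : \prod_(j <- J) P (X j @^-1` B' j) =
               \prod_(j <- J) P (X j @^-1` B j))%E; last first.
    apply: eq_big_seq => i iJ; rewrite /B'; case: eqP => // ie.
    by rewrite -ie iJ in enJ.
  rewrite {1}/B' eqxx /c [X in (X * _)%E]muleC -!muleA lee_wpmul2l //.
  apply: (@le_trans _ _ ((rho ^+ k)%:E *
    (2 ^+ size s * (2 * rho) ^+ (m - k))%:E)%E).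
    rewrite lee_wpmul2r // ?tail_K // lee_fin mulr_ge0 ?exprn_ge0 //.
    by rewrite mulr_ge0.
  rewrite -!EFinM lee_fin.
  have -> : (2 * rho) ^+ m = (2 * rho) ^+ (m - k) * (rho ^+ k * 2 ^+ k).
    by rewrite -exprMn [rho * 2]mulrC -exprD subnK.
  rewrite exprVn le_eqVlt; apply/orP; left; apply/eqP.
  have : (2 ^+ k : R) != 0 by rewrite expf_neq0.
  move: (2 ^+ k) ((2 * rho) ^+ _) (rho ^+ k) (2 ^+ size s) => a b c' e' a0.
  by field.
rewrite -ge0_sume_distrr /=; last by move=> i _; rewrite lee_fin exprn_ge0.
rewrite sumEFin lee_wpmul2l //; last first.
  rewrite lee_fin.
  have -> : \sum_(i < m.+1) (2^-1 : R) ^+ i = 2 - 2^-1 ^+ m.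
    elim: {uJ mF F c} m => [|m IHm]; first by rewrite big_ord1 !expr0; ring.
    by rewrite big_ord_recr /= IHm exprS; field.
  by rewrite gerBl exprn_ge0.
by rewrite /c mule_ge0 // lee_fin mulr_ge0 // exprn_ge0 // mulr_ge0.
Qed.

(** The factor [2 ^ size s * 2 ^ m] bounds the number of ways to write [m] as a
sum of [size s] terms; each of them is exceeded termwise with probability at
most [rho ^ m]. *)
Lemma count_tail s m : uniq s ->
  (P [set w | (m <= count_sum s w)%N] <=
     (2 ^+ size s * (2 * rho) ^+ m)%:E)%E.
Proof.
move=> us; have := @count_tail_joint s [::] (fun=> setT) m.
rewrite cats0 big_nil mul1e classical_sets.set_nil bigcap_set0 setTI; exact.
Qed.

End CountTail.

(** * The cost of a long path is linear in its length *)

Lemma measure_bigsetU_le_seq {R : realType} {disp : measure_display}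
    {T : measurableType disp} (mu : {measure set T -> \bar R}) (J : Type)
    (r : seq J) (F : J -> set T) (b : R) :
  (forall j, measurable (F j)) -> (forall j, (mu (F j) <= b%:E)%E) ->
  (mu (\big[setU/set0]_(j <- r) F j) <= ((size r)%:R * b)%:E)%E.
Proof.
move=> mF Fb; elim: r => [|j r IH]; first by rewrite big_nil measure0 mul0r.
rewrite big_cons; apply: le_trans (measureU2 _ _ _) _ => //.
  by elim: r {IH} => [|i r IH]; rewrite ?big_nil // big_cons; exact: measurableU.
by rewrite /= -natr1 mulrDl mul1r addrC EFinD leeD.
Qed.

Section LinearTimes.
Context {R : realType} {disp : measure_display} {Omega : measurableType disp}.
Context {P : probability Omega R} {d : nat} (X : edge d -> {RV P >-> R}).
Variable rate : edge d -> R.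
Hypotheses (d_gt0 : (0 < d)%N) (indepX : mutually_independent X).
Hypotheses (rate_gt0 : forall e, 0 < rate e)
  (lawX : forall e, has_exponential_law (X e) (rate e)).

(** Large enough for the per-edge factor [2 / chi] of [prob_bad] to beat the
number [2 * d] of steps available at each vertex and the factor [2 ^ d] that
accounts for the choice of the starting point. *)
Definition chi : nat := (8 * d * 2 ^ d)%N.
Definition time_lo : R := (4 * chi%:R ^+ 2)^-1.
Definition time_hi : R := 2 * chi.+1%:R.

Let chi_gt0 : (0 < chi)%N.
Proof. by rewrite /chi !muln_gt0 d_gt0 expn_gt0. Qed.

Let chiR_gt0 : 0 < chi%:R :> R.
Proof. by rewrite ltr0n. Qed.

Lemma time_lo_gt0 : 0 < time_lo.
Proof. by rewrite /time_lo invr_gt0 mulr_gt0 // exprn_gt0. Qed.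

Lemma time_hi_gt0 : 0 < time_hi.
Proof. by rewrite /time_hi mulr_gt0. Qed.

(** A path costs less than [time_lo] per edge only if half of its edges are
fast, and more than [time_hi] per edge only if its total excess is a large
multiple of its length. Both counts are functions of the rescaled time [rate e
* x], whose law is exponential of rate [1]. *)
Definition fast (e : edge d) (x : R) : nat := (rate e * x <= 2 * time_lo)%R.
Definition excess (e : edge d) (x : R) : nat := Num.truncn (rate e * x / 2).

Let mX e (B : set R) : measurable B -> measurable (X e @^-1` B).
Proof. by move=> mB; rewrite -[_ @^-1` _]setTI; exact: measurable_funP. Qed.

Lemma fastE e k : [set x | (k <= fast e x)%N] =
  if k is k'.+1 then
    if k' is 0 then `]-oo, (2 * time_lo / rate e)]%classic else set0
  else setT.
Proof.
case: k => [|[|k]]; apply/seteqP; split => x //=; rewrite /fast ?in_itv /=.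
- by rewrite lt0b (ler_pdivlMr _ _ (rate_gt0 e)) [x * _]mulrC.
- by rewrite lt0b (ler_pdivlMr _ _ (rate_gt0 e)) [x * _]mulrC.
- by case: (_ <= _).
Qed.

Lemma measurable_fast e k : measurable [set x | (k <= fast e x)%N].
Proof. by rewrite fastE; case: k => [|[|k]]. Qed.

Lemma tail_fast e k :
  (P (X e @^-1` [set x | (k <= fast e x)%N]) <= ((2 * time_lo) ^+ k)%:E)%E.
Proof.
have lo0 : 0 <= 2 * time_lo by rewrite mulr_ge0 // ltW // time_lo_gt0.
rewrite fastE; case: k => [|[|k]].
- by rewrite expr0; apply: probability_le1; exact: mX.
- apply: le_trans (exponential_le (rate_gt0 e) (lawX e) _) _.
    by rewrite divr_ge0 // ltW.
  by rewrite expr1 mulrC divfK // gt_eqF.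
- by rewrite preimage_set0 measure0 lee_fin exprn_ge0.
Qed.

Lemma excessE e k : [set x | (k <= excess e x)%N] =
  if k is k'.+1 then `[(2 * k%:R / rate e), +oo[%classic else setT.
Proof.
case: k => [|k]; apply/seteqP; split => x //=; rewrite in_itv /= andbT.
  rewrite /excess truncn_gt_nat ler_pdivlMr // mulrC [rate e * x]mulrC.
  by rewrite -ler_pdivrMr.
rewrite /excess truncn_gt_nat ler_pdivlMr // [k.+1%:R * _]mulrC [rate e * x]mulrC.
by rewrite -ler_pdivrMr.
Qed.

Lemma measurable_excess e k : measurable [set x | (k <= excess e x)%N].
Proof. by rewrite excessE; case: k. Qed.

Lemma tail_excess e k :
  (P (X e @^-1` [set x | (k <= excess e x)%N]) <= (4^-1 ^+ k)%:E)%E.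
Proof.
rewrite excessE; case: k => [|k].
  by rewrite expr0; apply: probability_le1; exact: mX.
apply: le_trans (exponential_ge (rate_gt0 e) (lawX e) _) _.
  by rewrite divr_gt0 // mulr_gt0.
rewrite lee_fin mulrC divfK ?gt_eqF // expRN exprVn lef_pV2 ?posrE ?exprn_gt0 ?expR_gt0 //.
have exp2 : 4 <= expR 2 :> R.
  have -> : 2 = 1 * 2%:R :> R by rewrite mul1r.
  rewrite expRM_natr; have := @expR_ge1Dx R 1; rewrite -[1 + 1]/2%:R => le2.
  have -> : 4 = 2 ^+ 2 :> R by ring.
  by rewrite lerXn2r ?nnegrE ?expR_ge0.
by rewrite expRM_natr lerXn2r ?nnegrE ?expR_ge0.
Qed.

Definition bad (s : seq (edge d)) : set Omega :=
  [set w | (uphalf (size s) <= count_sum X fast s w)%N] `|`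
  [set w | (chi * size s <= count_sum X excess s w)%N].

Lemma measurable_bad s : measurable (bad s).
Proof.
by apply: measurableU; apply: measurable_count_sum => e k;
  [exact: measurable_fast | exact: measurable_excess].
Qed.

Lemma prob_bad s : uniq s ->
  (P (bad s) <= (2 * (2 / chi%:R) ^+ size s)%:E)%E.
Proof.
move=> us; set n := size s.
have lo0 : 0 <= 2 * time_lo by rewrite mulr_ge0 // ltW // time_lo_gt0.
apply: le_trans (measureU2 _ _ _) _.
- by apply: measurable_count_sum => e k; exact: measurable_fast.
- by apply: measurable_count_sum => e k; exact: measurable_excess.
apply: (@le_trans _ _ ((2 ^+ n * (2 * (2 * time_lo)) ^+ uphalf n)%:E +
                       (2 ^+ n * (2 * 4^-1) ^+ (chi * n))%:E)%E).
  have hi0 : 0 <= 4^-1 :> R by rewrite invr_ge0.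
  apply: leeD.
    exact: (count_tail measurable_fast indepX lo0 tail_fast).
  exact: (count_tail measurable_excess indepX hi0 tail_excess).
have -> : 2 * (2 / chi%:R) ^+ n = 2 ^+ n * chi%:R ^- n + 2 ^+ n * chi%:R ^- n :> R.
  by rewrite expr_div_n; ring.
rewrite -EFinD lee_fin; apply: lerD; rewrite ler_pM2l ?exprn_gt0 //.
  have -> : 2 * (2 * time_lo) = chi%:R^-1 ^+ 2.
    by rewrite /time_lo; field; rewrite gt_eqF.
  rewrite -exprM -exprVn; apply: ler_wiXn2l.
  - by rewrite invr_ge0 ltW.
  - by rewrite invf_le1 // ler1n.
  - by rewrite mul2n; lia.
have -> : 2 * 4^-1 = 2^-1 :> R by field.
rewrite exprM -[leRHS]exprVn; apply: lerXn2r.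
- by rewrite nnegrE exprn_ge0 // invr_ge0.
- by rewrite nnegrE invr_ge0 ltW.
rewrite exprVn lef_pV2 ?posrE ?exprn_gt0 // -natrX ler_nat.
by apply: ltnW; exact: ltn_expl.
Qed.

Variable M : nat.

Definition near_walks n : seq (seq (edge d)) :=
  [seq s <- flatten [seq walks v n | v <- box (M * n)] | uniq s].

Definition bad_size n : set Omega := \big[setU/set0]_(s <- near_walks n) bad s.

Lemma measurable_bad_size n : measurable (bad_size n).
Proof.
rewrite /bad_size; elim: near_walks => [|s r IH]; rewrite ?big_nil // big_cons.
by apply: measurableU => //; exact: measurable_bad.
Qed.

Lemma size_near_walks n :
  (size (near_walks n) <= (M.*2.+1 ^ d) * (2 ^ d * d.*2) ^ n)%N.
Proof.
rewrite size_filter; apply: leq_trans (count_size _ _) _.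
rewrite size_flatten /shape -map_comp sumnE big_map.
rewrite (eq_bigr (fun=> (d.*2 ^ n)%N)) => [|v _]; last exact: size_walks.
rewrite big_const_seq iter_addn_0 count_predT size_box.
rewrite [X in (_ <= _ * X)%N]expnMn mulnA [X in (_ <= X)%N]mulnC leq_mul2l; apply/orP; right.
rewrite expnAC -expnMn leq_exp2r //.
by have := ltn_expl n (isT : 1 < 2)%N; nia.
Qed.

Lemma prob_bad_size n :
  (P (bad_size n) <= (4 * (M.*2.+1 ^ d)%:R / (2 ^ (n + 1))%:R)%:E)%E.
Proof.
have mb s : measurable (if uniq s && (size s == n) then bad s else set0).
  by case: ifP => // _; exact: measurable_bad.
have pb s : (P (if uniq s && (size s == n) then bad s else set0) <=
    (2 * (2 / chi%:R) ^+ n)%:E)%E.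
  case: ifP => [/andP[us /eqP <-]|_]; first exact: prob_bad.
  by rewrite measure0 lee_fin mulr_ge0 // exprn_ge0 // divr_ge0 // ltW.
have -> : bad_size n = \big[setU/set0]_(s <- near_walks n)
    (if uniq s && (size s == n) then bad s else set0).
  apply: eq_big_seq => s; rewrite mem_filter => /andP[-> /flattenP[l]] /=.
  by case/mapP => v _ ->; rewrite mem_walks => /andP[_ ->].
apply: le_trans (measure_bigsetU_le_seq _ mb pb) _.
rewrite lee_fin; apply: (@le_trans _ _
    ((M.*2.+1 ^ d * (2 ^ d * d.*2) ^ n)%N%:R * (2 * (2 / chi%:R) ^+ n))).
  apply: ler_wpM2r; first by rewrite mulr_ge0 // exprn_ge0 // divr_ge0 // ltW.
  by rewrite ler_nat; exact: size_near_walks.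
have E : (2 ^ d * d.*2)%N%:R * (2 / chi%:R) = 2^-1 :> R.
  rewrite /chi -muln2 !natrM natrX; field.
  by rewrite pnatr_eq0 -lt0n d_gt0 expf_neq0.
rewrite natrM [((2 ^ d * d.*2) ^ n)%N%:R]natrX.
have -> : forall a b c : R, a * b ^+ n * (2 * c ^+ n) = 2 * a * (b * c) ^+ n.
  by move=> a b c; rewrite exprMn; ring.
rewrite E addn1 [(2 ^ n.+1)%N%:R]natrX exprS exprVn le_eqVlt; apply/orP; left; apply/eqP.
by field; rewrite expf_neq0.
Qed.

(** There are only exponentially many self-avoiding paths of length [n] that
start at distance at most [M * n], and each of them violates the bounds with a
smaller exponential probability: conclude by Borel-Cantelli. The constants
[time_lo] and [time_hi] do not depend on [M], which is what lets the weight be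
chosen after them. *)
Lemma linear_times : {ae P, forall w, (forall e, 0 < X e w) ->
  exists n0, forall n v s, (n0 <= n)%N -> (nrm1 v <= M * n)%N ->
    simple v s -> size s = n ->
    time_lo * n%:R <= \sum_(e <- s) rate e * X e w <= time_hi * n%:R}.
Proof.
exists (lim_sup_set bad_size); split.
- apply: bigcap_measurable => // k _; apply: bigcup_measurable => j _.
  exact: measurable_bad_size.
- apply: lim_sup_set_cvg0; first exact: measurable_bad_size.
  apply: (@le_lt_trans _ _ (\sum_(n <oo) 
      (4 * (M.*2.+1 ^ d)%:R / (2 ^ (n + 1))%:R)%:E)%E).
    by apply: lee_nneseries => // n _; exact: prob_bad_size.
  by rewrite (cvg_lim _ (@cvg_geometric_eseries_half R _ 0)) // ltry.
- move=> w /=; apply: contra_notP => H W0.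
  have [k Hk] : exists k, forall j, (k <= j)%N -> ~ bad_size j w.
    apply: contra_notP H => /forallNP H k _.
    have /existsNP[j /not_implyP[kj /contrapT Bj]] := H k.
    by exists j.
  exists k => n v s kn vn sv sn.
  have us := simple_uniq sv.
  have nb : ~ bad s w.
    move=> Bs; apply: (Hk n kn); rewrite /bad_size -bigcup_seq; exists s => //=.
    rewrite mem_filter us; apply/flattenP; exists (walks v n).
      by apply: map_f; exact: mem_box.
    by rewrite mem_walks sn eqxx andbT; case/andP: sv.
  move: nb => /not_orP[/= /negP + /negP]; rewrite -!ltnNge sn.
  rewrite /count_sum => Hlo Hhi; apply/andP; split.
    have : 2 * time_lo * (n%:R - (\sum_(e <- s) fast e (X e w))%:R) <=
        \sum_(e <- s) rate e * X e w.
      rewrite -sn -sum1_size !natr_sum -sumrB mulr_sumr; apply: ler_sum => e _.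
      rewrite /fast; case: (leP (rate e * X e w) (2 * time_lo)) => [_|/ltW H']; last first.
        by rewrite mulr0n subr0 mulr1.
      by rewrite mulr1n subrr mulr0 mulr_ge0 // ltW.
    apply: le_trans.
    rewrite [2 * _]mulrC -mulrA ler_pM2l ?time_lo_gt0 //.
    set m := (\sum_(e <- s) _)%N in Hlo *.
    have : (2 * m <= n)%N by lia.
    by rewrite -(ler_nat R) natrM => ?; lra.
  have : \sum_(e <- s) rate e * X e w <=
      2 * ((\sum_(e <- s) excess e (X e w))%:R + n%:R).
    rewrite -sn -sum1_size !natr_sum -big_split mulr_sumr; apply: ler_sum => e _ /=.
    have := truncnS_gt (rate e * X e w / 2); rewrite ltr_pdivrMr // => /ltW.
    by rewrite -natr1 [_ * 2]mulrC.
  move=> /le_trans; apply; rewrite /time_hi -[leRHS]mulrA.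
  apply: ler_wpM2l => //; rewrite -natrM -natrD ler_nat mulSn addnC leq_add2l.
  exact: ltnW.
Qed.

End LinearTimes.

(** * Explosion times do not tie *)

Section NoTie.
Context {R : realType} {disp : measure_display} {Omega : measurableType disp}.
Context {P : probability Omega R} {I : countType} (X : I -> {RV P >-> R}).
Hypothesis indepX : mutually_independent X.
Variable i0 : I.

Let mX i (B : set R) : measurable B -> measurable (X i @^-1` B).
Proof. by move=> mB; rewrite -[_ @^-1` _]setTI; exact: measurable_funP. Qed.

(** A class stable under intersection that generates the events determined by
the variables other than [X i0]. *)
Definition off_cylinder : set (set Omega) :=
  [set E | exists (J : seq I) (B : I -> set R),
     [/\ uniq J, i0 \notin J, forall i, measurable (B i) &
         E = \bigcap_(i in [set` J]) (X i @^-1` B i)]].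

Lemma measurable_off_cylinder : off_cylinder `<=` measurable.
Proof.
move=> _ [J [B [uJ _ mB ->]]].
apply: fin_bigcap_measurable => [|i _]; first exact: finite_seq.
exact: mX.
Qed.

Lemma off_cylinder_setI : setI_closed off_cylinder.
Proof.
move=> _ _ [J [B [uJ iJ mB ->]]] [J' [B' [uJ' iJ' mB' ->]]].
exists (undup (J ++ J')), (fun i => (if i \in J then B i else setT) `&`
  (if i \in J' then B' i else setT)); split.
- exact: undup_uniq.
- by rewrite mem_undup mem_cat negb_or iJ.
- by move=> i; apply: measurableI; case: ifP.
apply/seteqP; split => w /=.
  by move=> [H H'] i /= _; split; case: ifP => //; [exact: H|exact: H'].
move=> H; split=> i /= iJJ; have := H i; rewrite /= mem_undup mem_cat iJJ ?orbT;
  by move=> /(_ isT)[].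
Qed.

(** As functions of [E], both sides are finite measures that agree on the
cylinders, a class stable under intersection. *)
Lemma off_sigma_independent (A : set R) (E : set Omega) :
  measurable A -> <<s off_cylinder>> E ->
  (P (E `&` X i0 @^-1` A) = P (X i0 @^-1` A) * P E)%E.
Proof.
move=> mA; have mXA := mX i0 mA.
have PA0 : 0 <= fine (P (X i0 @^-1` A)) by rewrite fine_ge0.
have PAE : (fine (P (X i0 @^-1` A)))%:E = P (X i0 @^-1` A).
  by rewrite fineK // fin_num_measure.
rewrite -PAE.
apply: (@g_sigma_algebra_measure_unique _ _ _ off_cylinder
  measurable_off_cylinder (fun=> setT) _ _
  (mrestr P mXA) (mscale (NngNum PA0) P)).
- move=> _; exists [::], (fun=> setT); split=> //.
  by rewrite classical_sets.set_nil bigcap_set0.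
- by rewrite bigcup_const //; exists 0%N.
- exact: off_cylinder_setI.
- move=> _ [J [B [uJ iJ mB ->]]].
  set E' := \bigcap_(i in _) _.
  suff : (P (E' `&` X i0 @^-1` A) = (fine (P (X i0 @^-1` A)))%:E * P E')%E by [].
  rewrite /E' PAE indepX //.
  pose B' i := if i == i0 then A else B i.
  have eB' i : i \in J -> B' i = B i.
    by move=> iJ'; rewrite /B'; case: eqP => // ii; rewrite -ii iJ' in iJ.
  rewrite (_ : _ `&` _ = \bigcap_(i in [set` (i0 :: J)]) (X i @^-1` B' i)).
    rewrite indepX; [|by rewrite /= iJ|by move=> i; rewrite /B'; case: eqP].
    rewrite big_cons {1}/B' eqxx; congr (_ * _)%E.
    by apply: eq_big_seq => i /eB' ->.
  apply/seteqP; split => w /=.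
    move=> [H HA] i /=; rewrite inE => /orP[/eqP ->|iJ'].
      by rewrite /B' eqxx.
    by rewrite /preimage eB' //; exact: H.
  move=> H; split => [i /= iJ'|].
    by have := H i; rewrite /= inE iJ' orbT eB' //; exact.
  by have := H i0; rewrite /= mem_head /B' eqxx; exact.
- move=> _; suff : (P (setT `&` X i0 @^-1` A) < +oo)%E by [].
  by rewrite setTI ltey_eq fin_num_measure.
Qed.

Local Notation OffT := (g_sigma_algebraType off_cylinder).

Lemma off_measurable_sum (s : seq I) : i0 \notin s ->
  measurable_fun (setT : set OffT) (fun w => \sum_(i <- s) X i w : R).
Proof.
move=> is0.
pose h i : OffT -> R := if i == i0 then cst 0 else X i.
rewrite (_ : (fun w => _) = (fun w => \sum_(i <- s) h i w)).
  apply: measurable_sum => i; rewrite /h; case: eqP => [_|/eqP ii].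
    exact: measurable_cst.
  move=> _ B mB; rewrite setTI; apply: sub_sigma_algebra.
  exists [:: i], (fun=> B); split => //; first by rewrite inE eq_sym.
  by rewrite set_cons1 bigcap_set1.
apply/funext => w; apply: eq_big_seq => i iS; rewrite /h; case: eqP => // ii.
by rewrite -ii iS in is0.
Qed.

(** When [S] consists of the self-avoiding extensions of a path, the infimum of
these [t] is the time at which explosion occurs along them. The map [g] serves
to discount the weight of one letter. *)
Definition live (S : pred (seq I)) (g : seq I -> seq I) (t : R) : set Omega :=
  [set w | forall n, exists s,
     [/\ S s, (n <= size s)%N & \sum_(i <- g s) X i w <= t]].

Implicit Types (S : pred (seq I)) (g : seq I -> seq I) (t : R).

Lemma live_le S g t t' : t <= t' -> live S g t `<=` live S g t'.
Proof.
by move=> tt w H n; have [s [? ? /le_trans H']] := H n; exists s; split => //;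
  exact: H'.
Qed.

Lemma off_measurable_live S g t : (forall s, S s -> i0 \notin g s) ->
  <<s off_cylinder>> (live S g t).
Proof.
move=> Sg; rewrite (_ : live S g t = \bigcap_n \bigcup_(s in [set: seq I])
    (if S s && (n <= size s)%N then
       [set w | \sum_(i <- g s) X i w <= t] else set0)); last first.
  apply/seteqP; split => w /=.
    by move=> H n _; have [s [Ss ns Hs]] := H n; exists s => //; rewrite Ss ns.
  move=> H n; have [s _] := H n Logic.I; case: ifP => // /andP[Ss ns] Hs.
  by exists s.
apply: (@bigcapT_measurable _ OffT) => n.
apply: (@countable_bigcupT_measurable _ OffT) => [|s]; first exact: countableP.
case: ifP => [/andP[Ss _]|_]; last exact: (@measurable0 _ OffT).
have := off_measurable_sum (Sg s Ss) measurableT.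
move=> /(_ `]-oo, t]%classic (measurable_itv _)).
rewrite setTI; congr (measurable _); apply/seteqP; split => w /=;
  by rewrite in_itv.
Qed.

Variable rate : R.
Hypotheses (rate_gt0 : 0 < rate) (lawX : has_exponential_law (X i0) rate).

(** The explosion time of [S1] is [X i0] plus a quantity that, like the
explosion time of [S2], does not depend on [X i0]. A tie thus makes [X i0]
equal to an independent quantity, which is impossible for a law without atoms.
To avoid integrating over the latter, both independent quantities are localized
in cells of a grid of mesh [h]: in each pair of cells [X i0] lies in a window
of length [2 * h], so a tie has probability at most [rate * (2 * h)]. *)
Lemma no_tie S1 S2 :
  (forall s, S1 s -> uniq s /\ i0 \in s) -> (forall s, S2 s -> i0 \notin s) ->
  {ae P, forall w, (forall i, 0 <= X i w) ->
    forall t, live S1 id t w -> live S2 id t w ->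
      exists2 t', t' < t & live S1 id t' w \/ live S2 id t' w}.
Proof.
move=> S1u S2i.
pose L1 t := live S1 (rem i0) t; pose L2 t := live S2 id t.
have mL1 t : <<s off_cylinder>> (L1 t).
  apply: off_measurable_live => s /S1u[us _].
  by rewrite mem_rem_uniq // !inE eqxx.
have mL2 t : <<s off_cylinder>> (L2 t) by exact: off_measurable_live.
have remE s w : S1 s ->
    \sum_(i <- s) X i w = X i0 w + \sum_(i <- rem i0 s) X i w.
  by move=> /S1u[_ si]; rewrite (perm_big _ (perm_to_rem si)) big_cons.
have L1E t w : live S1 id t w = L1 (t - X i0 w) w.
  apply/propext; split=> H n; have [s [Ss ns Hs]] := H n; exists s; split => //.
    by move: Hs; rewrite remE // lerBrDl.
  by rewrite remE // -lerBrDl.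
have sm E : <<s off_cylinder>> E -> measurable E.
  apply: smallest_sub; first exact: sigma_algebra_measurable.
  exact: measurable_off_cylinder.
pose cell (L : R -> set Omega) (h : R) (i : nat) :=
  L (i%:R * h) `\` L ((i%:R - 1) * h).
have mcell (L : R -> set Omega) h i : (forall t, <<s off_cylinder>> (L t)) ->
    <<s off_cylinder>> (cell L h i).
  by move=> mL; apply: (@measurableD _ OffT); exact: mL.
have cell_disj (L : R -> set Omega) h i j w : 0 < h ->
    (forall t t', t <= t' -> L t `<=` L t') ->
    cell L h i w -> cell L h j w -> i = j.
  move=> h0 Lle; wlog ij : i j / (i < j)%N => [WL Ci Cj|[Li _] [_ []]].
    by have [ij|ji|//] := ltngtP i j; [exact: WL|apply/esym/WL].
  by apply: Lle Li; rewrite ler_pM2r // lerBrDr natr1 ler_nat.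
have L1le t t' : t <= t' -> L1 t `<=` L1 t' by exact: live_le.
have L2le t t' : t <= t' -> L2 t `<=` L2 t' by exact: live_le.
pose win h (i j : nat) : set R :=
  `[(i%:R - 1 - j%:R) * h, (i%:R - (j%:R - 1)) * h]%classic.
pose base h (k : nat) : set Omega :=
  if @pickle_inv (nat * nat)%type k is Some (i, j) then cell L2 h i `&` cell L1 h j else set0.
pose F h (k : nat) : set Omega :=
  if @pickle_inv (nat * nat)%type k is Some (i, j) then
    (cell L2 h i `&` cell L1 h j) `&` X i0 @^-1` win h i j else set0.
have mbase h k : measurable (base h k).
  rewrite /base; case: pickle_inv => [[i j]|] //.
  by apply: measurableI; apply: sm; exact: mcell.
have mwin h i j : measurable (win h i j) by exact: measurable_itv.
have mF h k : measurable (F h k).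
  rewrite /F; case: pickle_inv => [[i j]|] //.
  by apply: measurableI; [apply: measurableI; apply: sm; exact: mcell|exact: mX].
have PF h k : 0 < h -> (P (F h k) <= (rate * (2 * h))%:E * P (base h k))%E.
  move=> h0; rewrite /F /base; case: pickle_inv => [[i j]|]; last first.
    by rewrite measure0 mule0.
  rewrite off_sigma_independent //; last first.
    by apply: (@measurableI _ OffT); exact: mcell.
  apply: lee_wpmul2r => //.
  apply: le_trans (exponential_le_length rate_gt0 lawX (mwin _ _ _)) _.
  rewrite EFinM; apply: lee_wpmul2l; first by rewrite lee_fin ltW.
  rewrite lebesgue_measure_itv /=; case: ifP => _; rewrite -?EFinB lee_fin.
    by rewrite le_eqVlt; apply/orP; left; apply/eqP; ring.
  by rewrite mulr_ge0 // ltW.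
have PUF h : 0 < h -> (P (\bigcup_k F h k) <= (rate * (2 * h))%:E)%E.
  move=> h0; apply: le_trans (generalized_Boole_inequality _ _ _) _ => //.
    exact: bigcupT_measurable.
  apply: (@le_trans _ _ (\sum_(k <oo) ((rate * (2 * h))%:E * P (base h k)))%E).
    by apply: lee_nneseries => // k _; exact: PF.
  have c0 : 0 <= rate * (2 * h) by rewrite mulr_ge0 ?ltW // mulr_gt0.
  rewrite nneseriesZl //.
  rewrite -[leRHS]mule1 lee_wpmul2l // ?lee_fin //.
  rewrite -measure_semi_bigcup //; last 2 first.
    move=> k l _ _ [w [/= bk bl]]; move: bk bl; rewrite /base.
    have := @pickle_invK (nat * nat)%type k; have := @pickle_invK (nat * nat)%type l.
    case: pickle_inv => [[i j]|//] /= <-; case: pickle_inv => [[i' j']|//] /= <-.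
    move=> [Ci Cj] [Ci' Cj'].
    have ii := cell_disj _ _ _ _ _ h0 L2le Ci Ci'.
    have jj := cell_disj _ _ _ _ _ h0 L1le Cj Cj'.
    by rewrite ii jj.
    exact: bigcupT_measurable.
  by apply: probability_le1; exact: bigcupT_measurable.
pose U := \bigcap_n \bigcup_k F (n.+1%:R^-1) k.
have mU : measurable U by apply: bigcapT_measurable => n; exact: bigcupT_measurable.
exists U; split => //.
  apply/eqP; rewrite eq_le measure_ge0 andbT; apply/lee_addgt0Pr => e e0.
  have [n Hn] : exists n, rate * (2 * n.+1%:R^-1) <= e.
    exists (Num.truncn (rate * 2 / e)); rewrite mulrA ler_pdivrMr //.
    by rewrite -ler_pdivrMl // mulrC; apply: ltW; exact: truncnS_gt.
  rewrite add0e; apply: (@le_trans _ _ (rate * (2 * n.+1%:R^-1))%:E) => //.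
  apply: le_trans (PUF _ _) => //; apply: le_measure; rewrite ?inE //.
    exact: bigcupT_measurable.
  by move=> w /(_ n); exact.
move=> w /= H n _; set h := n.+1%:R^-1.
have h0 : 0 < h by rewrite invr_gt0.
move: H => /not_implyP[X0 /existsNP[t /not_implyP[H1 /not_implyP[H2 H]]]].
have {H} [H1' H2'] : (forall t', t' < t -> ~ live S1 id t' w) /\
    (forall t', t' < t -> ~ live S2 id t' w).
  by split=> t' tt Ht; apply: H; exists t' => //; [left|right].
have sum_ge0 s : 0 <= \sum_(i <- s) X i w by apply: sumr_ge0 => i _.
have t0 : 0 <= t by have [s [_ _ /(le_trans (sum_ge0 s))]] := H2 0%N.
have incell (L : R -> set Omega) u : (forall t t', t <= t' -> L t `<=` L t') ->
    0 <= u -> L u w -> (forall u', u' < u -> ~ L u' w) ->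
    exists i : nat, [/\ cell L h i w, u <= i%:R * h & (i%:R - 1) * h < u].
  move=> Lle u0 Lu Lu'.
  have exi : exists i : nat, u <= i%:R * h.
    exists (Num.truncn (u / h)).+1; rewrite -ler_pdivrMr //; apply: ltW.
    exact: truncnS_gt.
  have lei : (ex_minn exi)%:R * h - h < u.
    case: ex_minnP => -[|i] ui Hi.
      by rewrite mul0r sub0r; apply: lt_le_trans u0; rewrite oppr_lt0.
    rewrite -natr1 mulrDl mul1r addrK ltNge; apply/negP => /Hi.
    by rewrite ltnn.
  move: lei; case: ex_minnP => i ui _ lei.
  have lei' : (i%:R - 1) * h < u by rewrite mulrBl mul1r.
  exists i; split => //; split; first exact: Lle Lu.
  exact: Lu'.
have [i [Ci ui li]] := incell L2 t L2le t0 H2 H2'.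
rewrite L1E in H1.
have [j [Cj uj lj]] : exists j : nat, [/\ cell L1 h j w, t - X i0 w <= j%:R * h
    & (j%:R - 1) * h < t - X i0 w].
  apply: incell => //.
    by have [s [_ _ /(le_trans (sum_ge0 _))]] := H1 0%N.
  move=> u' u'lt Hu'; apply: (H1' (u' + X i0 w)); first by rewrite -ltrBrDr.
  by rewrite L1E addrK.
exists (pickle (i, j)) => //; rewrite /F pickleK_inv; split; first by split.
rewrite /preimage /win /= in_itv /=; apply/andP; split.
  by rewrite mulrBl; lra.
by rewrite mulrBl; lra.
Qed.

End NoTie.

(** * The cluster at the explosion time *)

Lemma seq_uniform_bound (T : eqType) (l : seq T) (Q : T -> nat -> Prop) :
  (forall x m n, (m <= n)%N -> Q x m -> Q x n) ->
  (forall x, x \in l -> exists n, Q x n) ->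
  exists n, forall x, x \in l -> Q x n.
Proof.
move=> Qle; elim: l => [|x l IH] H; first by exists 0%N.
have [y yl|n Hn] := IH; first by apply: H; rewrite inE yl orbT.
have [m Hm] := H x (mem_head _ _).
exists (maxn m n) => y; rewrite inE => /orP[/eqP ->|/Hn Qn].
  exact: Qle (leq_maxl _ _) Hm.
exact: Qle (leq_maxr _ _) Qn.
Qed.

Lemma seq_uniform_gap (R : realType) (T : eqType) (l : seq T) (F : T -> R) (t : R) :
  (forall x, x \in l -> t < F x) ->
  exists2 eps, 0 < eps & forall x, x \in l -> t + eps <= F x.
Proof.
elim: l => [|x l IH] H; first by exists 1.
have [y yl|eps e0 He] := IH; first by apply: H; rewrite inE yl orbT.
exists (Num.min eps (F x - t)).
  by rewrite lt_min e0 subr_gt0 H ?mem_head.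
move=> y; rewrite inE => /orP[/eqP ->|/He].
  by rewrite -lerBrDl ge_min lexx orbT.
by apply: le_trans; rewrite lerD2l ge_min lexx.
Qed.

Lemma first_difference (T : eqType) (p q : seq T) :
  size p = size q -> p != q ->
  exists r e e' p' q', [/\ e != e', p = rcons r e ++ p' & q = rcons r e' ++ q'].
Proof.
elim: p q => [|e p IH] [|e' q] //= [] szpq.
have [->|ee' _] := eqVneq e e'; last first.
  by exists [::], e, e', p, q.
rewrite eqseq_cons eqxx => /(IH q szpq)[r [f [f' [p' [q' [ff -> ->]]]]]].
by exists (e' :: r), f, f', p', q'.
Qed.

Section Explosion.
Context {R : realType} {d : nat} (W : edge d -> R).
Hypothesis W_gt0 : forall e, 0 < W e.
Implicit Types (s p : seq (edge d)) (v : 'rV[int]_d).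

Lemma path_time_cat s1 s2 :
  path_time W (s1 ++ s2) = path_time W s1 + path_time W s2.
Proof. exact: big_cat. Qed.

Lemma path_time_ge0 s : 0 <= path_time W s.
Proof. by apply: sumr_ge0 => e _; exact: ltW. Qed.

Lemma path_time_gt0 s : (0 < size s)%N -> 0 < path_time W s.
Proof.
case: s => // e s _; rewrite /path_time big_cons.
by apply: ltr_pwDl => //; exact: path_time_ge0.
Qed.

Lemma path_time_subseq s s' : subseq s' s -> path_time W s' <= path_time W s.
Proof.
elim: s s' => [|e s IH] [|e' s'] //=.
  by move=> _; rewrite {1}/path_time big_nil path_time_ge0.
rewrite /path_time !big_cons; case: eqP => [->|_].
  by move=> /IH; rewrite lerD2l.
by move=> /IH; rewrite /path_time big_cons => /le_trans; apply;
  rewrite lerDr ltW.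
Qed.

(** The edges of a long path are pairwise distinct, so the cluster at the
bounding time has infinitely many of them. *)
Lemma tau_infty_le s (b : R) : walk 0 s ->
  (forall n, exists s', [/\ (n <= size s')%N, walk (endp 0 s) s', uniq s' &
     path_time W s' <= b]) ->
  (tau_infty W <= (path_time W s + b)%:E)%E.
Proof.
move=> ws H; apply: ereal_inf_lbound; exists (path_time W s + b) => //; split.
  have [s' [ns _ _ Hb]] := H 1%N.
  apply: ltr_wpDl; first exact: path_time_ge0.
  by apply: lt_le_trans Hb; exact: path_time_gt0.
move=> /finite_seqP[l El].
have [s' [ns ws' us' Hb]] := H (size l).+1.
suff : (size s' <= size l)%N by rewrite leqNgt ns.
apply: uniq_leq_size => // e es'.
suff : cluster_edges W (path_time W s + b)%:E e by rewrite El.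
have : walk 0 (s ++ s') by rewrite walk_cat ws.
have : path_time W (s ++ s') <= path_time W s + b.
  by rewrite path_time_cat lerD2l.
have : e \in s ++ s' by rewrite mem_cat es' orbT.
case: (s ++ s') => [//|e0 s0] ein Ht w0.
exists e0, s0, 0, (endp 0 (e0 :: s0)); split => //.
  by rewrite is_pathE w0 eqxx.
by case/andP: w0.
Qed.

(** The infimum of these [t] is the explosion time along the self-avoiding
paths that begin with [p]. *)
Definition cheap p (t : R) : Prop := forall n, exists s,
  [/\ simple 0 s && prefix p s, (n <= size s)%N & path_time W s <= t].

Lemma cheap_catl p q t : cheap (p ++ q) t -> cheap p t.
Proof.
move=> H n; have [s [/andP[ss pq] ns st]] := H n; exists s; split => //.
rewrite ss /=; exact: prefix_trans (prefix_prefix _ _) pq.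
Qed.

Variable tau : R.
Hypothesis tauE : tau_infty W = tau%:E.

Lemma not_cheap p t : t < tau -> ~ cheap p t.
Proof.
move=> tt H; suff : (tau_infty W <= (path_time W [::] + t)%:E)%E.
  by rewrite tauE /path_time big_nil add0r lee_fin leNgt tt.
apply: tau_infty_le => // n; have [s [/andP[ss _] ns st]] := H n; exists s.
by split => //; [case/andP: ss|exact: simple_uniq ss].
Qed.

(** Without its last edge a long path to [v] already costs more than [tau]
minus any given amount, and the last edge adds a positive cost that depends on
[v] only. *)
Lemma long_path_cost v : exists k eps, 0 < eps /\ forall s,
  simple 0 s -> endp 0 s = v -> (k <= size s)%N -> tau + eps < path_time W s.
Proof.
have [m m0 Hm] : exists2 m, 0 < m & forall e, e \in steps v -> 0 + m <= W e.
  exact: seq_uniform_gap.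
have m20 : 0 < m / 2 by rewrite divr_gt0.
have : ~ cheap [::] (tau - m / 2) by apply: not_cheap; rewrite ltrBlDr ltrDl.
move=> /existsNP[n Hn]; exists n.+1, (m / 2); split => //.
move=> s; case/lastP: s => // s e ss sv; rewrite size_rcons ltnS => ns.
have ss' : simple 0 s by apply: (@simple_catl _ _ s [:: e]); rewrite cats1.
have H1 : tau - m / 2 < path_time W s.
  rewrite ltNge; apply/negP => H; apply: Hn; exists s.
  by rewrite ss' prefix0s.
have /Hm : e \in steps v.
  rewrite mem_steps -sv endp_rcons; apply: incident_other.
  by move: ss => /andP[]; rewrite -cats1 walk_cat /= => /and3P[].
by rewrite -cats1 path_time_cat /path_time big_seq1 -/(path_time W s); lra.
Qed.

Local Notation V := (cluster_vertices W (tau_infty W)).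

Lemma mem_cluster s : walk 0 s -> path_time W s <= tau -> V (endp 0 s).
Proof.
move=> ws st; rewrite /cluster_vertices /= tauE.
apply: (@le_trans _ _ (path_time W s)%:E); rewrite ?lee_fin //.
by apply: ereal_inf_lbound; exists s => //=; rewrite is_pathE ws eqxx.
Qed.

(** By [long_path_cost] only finitely many self-avoiding paths compete for the
passage time, so it is attained, even when it equals [tau]. *)
Lemma geodesic v : V v ->
  exists s, [/\ simple 0 s, endp 0 s = v & path_time W s <= tau].
Proof.
rewrite /cluster_vertices /= tauE; apply: contraPP => /forallNP H.
have {}H s : simple 0 s -> endp 0 s = v -> tau < path_time W s.
  move=> ss sv; rewrite ltNge; apply/negP => st; exact: (H s).
have [k [eps [e0 Hk]]] := long_path_cost v.
pose l := [seq s <- flatten [seq walks (0 : 'rV[int]_d) n | n <- iota 0 k] |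
             simple 0 s && (endp 0 s == v)].
have [eps' e0' He] : exists2 eps', 0 < eps' &
    forall s, s \in l -> tau + eps' <= path_time W s.
  apply: seq_uniform_gap => s; rewrite mem_filter => /andP[/andP[ss /eqP sv] _].
  exact: H.
have Hs s : simple 0 s -> endp 0 s = v ->
    tau + Num.min eps eps' <= path_time W s.
  move=> ss sv; have [ks|sk] := leqP k (size s).
    apply: le_trans (ltW (Hk s ss sv ks)).
    by rewrite lerD2l ge_min lexx.
  apply: le_trans (He s _); first by rewrite lerD2l ge_min lexx orbT.
  rewrite mem_filter ss sv eqxx; apply/flattenP; exists (walks 0 (size s)).
    by apply: map_f; rewrite mem_iota.
  by rewrite mem_walks eqxx andbT; case/andP: ss.
apply/negP; rewrite -ltNge.
apply: (@lt_le_trans _ _ (tau + Num.min eps eps')%:E).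
  by rewrite lte_fin ltrDl lt_min e0 e0'.
apply/ereal_infP => _ [s /= sv <-]; rewrite lee_fin.
move: sv; rewrite is_pathE => /andP[ws /eqP sv].
have [s' [ss' es' sub]] := simple_subseq ws.
by apply: le_trans (path_time_subseq sub); apply: Hs => //; rewrite es'.
Qed.

Section Dichotomy.
Variables (Cp Cm : set 'rV[int]_d) (N0 : nat).
Hypothesis Cpm : forall v, Cp v -> Cm v -> False.
Hypothesis Cadj : forall v e, incident v e -> (N0 <= nrm1 v)%N ->
  ~ (Cm v /\ Cp (other e v)).

(** The part of a long path within time [tau] that lies outside a bounded set
cannot jump from [Cm] to [Cp]; hence infinitely many paths that end in [Cp] are
already in [Cp] at a fixed step, and one of the finitely many beginnings they
have is shared by arbitrarily long ones. *)
Lemma cheap_prefix k :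
  (forall v, V v -> (N0 <= nrm1 v)%N -> Cp v \/ Cm v) ->
  (forall s, simple 0 s -> path_time W s <= tau -> (k <= size s)%N ->
     (N0 <= nrm1 (endp 0 s))%N) ->
  infinite_set (V `&` Cp) ->
  exists p, [/\ size p = k, Cp (endp 0 p) & cheap p tau].
Proof.
move=> Vpm far inf.
have inCp s2 s1 : simple 0 (s1 ++ s2) -> path_time W (s1 ++ s2) <= tau ->
    (k <= size s1)%N -> Cp (endp 0 (s1 ++ s2)) -> Cp (endp 0 s1).
  elim: s2 s1 => [|e s2 IH] s1; first by rewrite cats0.
  rewrite -cat_rcons => ss st ks /(IH _ ss st).
  rewrite size_rcons (leq_trans ks) // => /(_ isT); rewrite endp_rcons => Ce.
  have ss1 : simple 0 s1.
    by move: ss; rewrite cat_rcons => /simple_catl.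
  have st1 : path_time W s1 <= tau.
    apply: le_trans st; rewrite cat_rcons path_time_cat lerDl.
    exact: path_time_ge0.
  have Ns1 := far _ ss1 st1 ks.
  have /Vpm[//|//|Cm1] : V (endp 0 s1).
    by apply: mem_cluster => //; case/andP: ss1.
  exfalso; apply: (Cadj (v := endp 0 s1) (e := e)) => //.
  move: ss => /andP[]; rewrite cat_rcons walk_cat /=.
  by move=> /and3P[].
apply: contra_notP inf => H.
have [n Hn] : exists n, forall p, p \in walks (0 : 'rV[int]_d) k ->
    Cp (endp 0 p) -> forall s, simple 0 s -> prefix p s -> (n <= size s)%N ->
      tau < path_time W s.
  apply: (@seq_uniform_bound _ _ (fun p n => Cp (endp 0 p) -> forall s,
     simple 0 s -> prefix p s -> (n <= size s)%N -> tau < path_time W s)).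
    by move=> p m n mn Hm Cpp s ss ps ns; apply: Hm => //; exact: leq_trans ns.
  move=> p; rewrite mem_walks => /andP[wp /eqP sp].
  have [Cpp|nCpp] := pselect (Cp (endp 0 p)); last by exists 0%N.
  have /existsNP[n nn] : ~ cheap p tau by move=> Hc; apply: H; exists p.
  exists n => _ s ss ps ns; rewrite ltNge; apply/negP => st; apply: nn.
  by exists s; rewrite ss ps.
apply: sub_finite_set (finite_nrm1 (n + k)) => v [Vv Cv] /=.
rewrite leqNgt; apply/negP => nkv.
have [s [ss sv st]] := geodesic Vv.
have szs : (n + k < size s)%N.
  apply: leq_trans nkv _; have := @nrm1_endp _ 0 s.
  by rewrite nrm10 add0n sv; apply; case/andP: ss.
have tk : size (take k s) = k by rewrite size_takel //; lia.
have : tau < path_time W s; last by rewrite ltNge st.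
apply: (Hn (take k s)) => //.
- rewrite mem_walks tk eqxx andbT.
  by move: ss; rewrite -{1}(cat_take_drop k s) => /simple_catl/andP[].
- by apply: (inCp (drop k s)); rewrite ?cat_take_drop ?tk ?sv.
- by rewrite prefix_take.
- by lia.
Qed.

End Dichotomy.

(** If the cluster met both regions infinitely often, [cheap_prefix] would give
two paths of the same length, one ending in [Cp] and the other in [Cm], along
which explosion occurs exactly at time [tau]. At the end of their common
beginning they take different edges, and such a tie is excluded. *)
Lemma cluster_one_sided (Cp Cm : set 'rV[int]_d) (N0 : nat) :
  (forall v, Cp v -> Cm v -> False) ->
  (forall v e, incident v e -> (N0 <= nrm1 v)%N ->
     ~ (Cm v /\ Cp (other e v)) /\ ~ (Cp v /\ Cm (other e v))) ->
  (forall v, V v -> (N0 <= nrm1 v)%N -> Cp v \/ Cm v) ->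
  (forall r e e' t, e != e' -> cheap (rcons r e) t -> cheap (rcons r e') t ->
     exists2 t', t' < t & cheap (rcons r e) t' \/ cheap (rcons r e') t') ->
  finite_set (V `\` Cp) \/ finite_set (V `\` Cm).
Proof.
move=> Cpm Cadj Vpm notie.
have [k Hk] : exists k, forall v, v \in box N0 -> forall s, simple 0 s ->
    endp 0 s = v -> (k <= size s)%N -> tau < path_time W s.
  apply: (@seq_uniform_bound _ _ (fun v k => forall s, simple 0 s ->
    endp 0 s = v -> (k <= size s)%N -> tau < path_time W s)).
    by move=> v m n mn Hm s ss sv ns; apply: Hm => //; exact: leq_trans ns.
  move=> v _; have [k [eps [e0 H]]] := long_path_cost v; exists k => s ss sv ks.
  by apply: lt_trans (H s ss sv ks); rewrite ltrDl.
have far s : simple 0 s -> path_time W s <= tau -> (k <= size s)%N ->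
     (N0 <= nrm1 (endp 0 s))%N.
  move=> ss st ks; rewrite leqNgt; apply/negP => /ltnW /mem_box Hb.
  by have := Hk _ Hb s ss erefl ks; rewrite ltNge st.
have fin_of (A B : set 'rV[int]_d) : (forall v, V v -> (N0 <= nrm1 v)%N ->
    A v \/ B v) -> finite_set (V `&` B) -> finite_set (V `\` A).
  move=> VAB fB; apply: (@sub_finite_set _ _
    ([set v | (nrm1 v <= N0)%N] `|` V `&` B)).
    move=> v [Vv nA] /=; have [|/ltnW N0v] := leqP (nrm1 v) N0; first by left.
    by right; split => //; have [] := VAB v Vv N0v.
  by rewrite finite_setU; split => //; exact: finite_nrm1.
have [fp|ip] := pselect (finite_set (V `&` Cp)).
  by right; apply: fin_of fp => v Vv Nv; have [] := Vpm v Vv Nv; auto.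
have [fm|im] := pselect (finite_set (V `&` Cm)).
  by left; apply: fin_of fm.
exfalso.
have [p [sp Ep cp]] : exists p, [/\ size p = k, Cp (endp 0 p) & cheap p tau].
  apply: (cheap_prefix (Cm := Cm) (N0 := N0)) => //.
  by move=> v e ve Nv; have [] := Cadj v e ve Nv.
have [q [sq Eq cq]] : exists p, [/\ size p = k, Cm (endp 0 p) & cheap p tau].
  apply: (cheap_prefix (Cm := Cp) (N0 := N0)) => //.
  - by move=> v e ve Nv; have [] := Cadj v e ve Nv.
  - by move=> v Vv Nv; have [] := Vpm v Vv Nv; auto.
have pq : p != q by apply/eqP => pq; apply: (Cpm (endp 0 p)); rewrite // pq.
have [|r [e [e' [p' [q' [ee pE qE]]]]]] := first_difference _ pq.
  by rewrite sp sq.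
rewrite pE in cp; rewrite qE in cq.
have [t' tt [c|c]] := notie r e e' tau ee (cheap_catl cp) (cheap_catl cq).
  exact: not_cheap tt c.
exact: not_cheap tt c.
Qed.

End Explosion.

(** * The weight, and rays in a coordinate direction *)

Lemma addz_succ_neq0 (z : int) : z + (z + 1) != 0.
Proof. by apply/eqP; lia. Qed.

Section Rays.
Context {d : nat} (i0 : 'I_d).
Implicit Types (v : 'rV[int]_d) (b : bool).

Definition shift b v : 'rV[int]_d :=
  if b then v + delta_mx 0 i0 else v - delta_mx 0 i0.

Definition ray_edge b v : edge d :=
  if b then (v, i0) else (v - delta_mx 0 i0, i0).

Fixpoint ray b v n : seq (edge d) :=
  if n is n'.+1 then ray_edge b v :: ray b (shift b v) n' else [::].

Lemma ray_edge_incident b v : incident v (ray_edge b v).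
Proof.
by case: b; rewrite /incident /ray_edge /edge_src /edge_tgt /= ?eqxx ?subrK
  ?eqxx ?orbT.
Qed.

Lemma other_ray_edge b v : other (ray_edge b v) v = shift b v.
Proof.
have := src_neq_tgt (ray_edge b v); case: b.
  by rewrite /other /ray_edge /edge_src /edge_tgt /= eqxx.
rewrite /other /ray_edge /edge_src /edge_tgt /= subrK eq_sym.
by case: eqP.
Qed.

Lemma size_ray b v n : size (ray b v n) = n.
Proof. by elim: n v => //= n IH v; rewrite IH. Qed.

Lemma walk_ray b v n : walk v (ray b v n).
Proof.
by elim: n v => //= n IH v; rewrite ray_edge_incident other_ray_edge IH.
Qed.

Lemma endp_ray b v n : endp v (ray b v n) = iter n (shift b) v.
Proof.
by elim: n v => //= n IH v; rewrite other_ray_edge IH -iterS iterSr.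
Qed.

Lemma ray_cat b v m n :
  ray b v (m + n) = ray b v m ++ ray b (iter m (shift b) v) n.
Proof. by elim: m v => //= m IH v; rewrite IH -iterS iterSr. Qed.

Lemma shift_coord b v :
  shift b v 0 i0 = if b then v 0 i0 + 1 else v 0 i0 - 1.
Proof. by rewrite /shift; case: b; rewrite !mxE !eqxx. Qed.

Lemma simple_ray b v n : simple v (ray b v n).
Proof.
rewrite /simple walk_ray /=.
have far m w x : x \in trace w (ray b w m) ->
    if b then w 0 i0 < x 0 i0 else x 0 i0 < w 0 i0.
  elim: m w => //= m IH w; rewrite other_ray_edge inE => /orP[/eqP ->|/IH].
    by rewrite shift_coord; case: b {IH}; lia.
  by rewrite shift_coord; case: b {IH}; lia.
elim: n v => //= n IH v; rewrite other_ray_edge IH andbT.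
apply/negP; have := far n.+1 v v; rewrite /= other_ray_edge => H /H.
by case: b {IH far H} => /=; rewrite ltxx.
Qed.

End Rays.

Section Weight.
Context {R : realType} {d : nat} (c : 'rV[R]_d) (i0 : 'I_d) (delta : R).
Hypothesis c_le1 : forall i, `|c 0 i| <= 1.
Hypothesis c_i0 : `|c 0 i0| = 1.
Hypotheses (delta_gt0 : 0 < delta) (delta_le : delta <= 2^-1).
Implicit Types (z : 'rV[R]_d) (v : 'rV[int]_d) (e : edge d) (b : bool).

Definition l1norm z : R := \sum_(i < d) `|z 0 i|.

(** Of order [l1norm z] near the axis of [c], but only [delta * l1norm z] near
the hyperplane orthogonal to [c], where edges are therefore slow. *)
Definition weight z : R := `|dot z c| + delta * l1norm z.

Lemma dotD z z' : dot (z + z') c = dot z c + dot z' c.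
Proof.
by rewrite /dot -big_split; apply: eq_bigr => i _; rewrite mxE mulrDl.
Qed.

Lemma dotZ (a : R) z : dot (a *: z) c = a * dot z c.
Proof. by rewrite /dot mulr_sumr; apply: eq_bigr => i _; rewrite mxE mulrA. Qed.

Lemma l1normD z z' : l1norm (z + z') <= l1norm z + l1norm z'.
Proof.
rewrite /l1norm -big_split; apply: ler_sum => i _; rewrite mxE; exact: ler_normD.
Qed.

Lemma l1normZ (a : R) z : l1norm (a *: z) = `|a| * l1norm z.
Proof.
by rewrite /l1norm mulr_sumr; apply: eq_bigr => i _; rewrite mxE normrM.
Qed.

Lemma l1norm_ge0 z : 0 <= l1norm z.
Proof. exact: sumr_ge0. Qed.

Lemma l1norm_eq0 z : l1norm z = 0 -> z = 0.
Proof.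
move=> /eqP; rewrite psumr_eq0 // => /allP H; apply/rowP => i; rewrite mxE.
by apply/eqP; rewrite -normr_eq0; apply: H; rewrite mem_index_enum.
Qed.

Lemma is_norm_weight : is_norm weight.
Proof.
split.
- move=> x y; rewrite /weight dotD.
  have := ler_normD (dot x c) (dot y c); have := l1normD x y.
  rewrite -(ler_pM2l delta_gt0) mulrDr; lra.
- by move=> a x; rewrite /weight dotZ l1normZ normrM; ring.
- move=> x; rewrite /weight => H; apply: l1norm_eq0.
  have h1 := normr_ge0 (dot x c).
  have h2 : 0 <= delta * l1norm x by rewrite mulr_ge0 ?l1norm_ge0 // ltW.
  have /eqP : delta * l1norm x = 0 by lra.
  by rewrite mulf_eq0 gt_eqF //= => /eqP.
Qed.

Lemma l1norm_le_weight z : delta * l1norm z <= weight z.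
Proof. by rewrite /weight lerDr. Qed.

Lemma weight_ge0 z : 0 <= weight z.
Proof.
apply: le_trans (l1norm_le_weight z).
by rewrite mulr_ge0 ?l1norm_ge0 // ltW.
Qed.

Lemma l1norm_delta i : l1norm (delta_mx 0 i) = 1.
Proof.
rewrite /l1norm (bigD1 i) //= big1 => [|j ji]; rewrite mxE eqxx /=.
  by rewrite eqxx normr1 addr0.
by rewrite (negPf ji) normr0.
Qed.

Lemma dot_delta i : dot (delta_mx 0 i) c = c 0 i.
Proof.
rewrite /dot (bigD1 i) //= big1 => [|j ji]; rewrite mxE eqxx /=.
  by rewrite eqxx mul1r addr0.
by rewrite (negPf ji) mul0r.
Qed.

Lemma weight_delta i : weight (delta_mx 0 i) <= 2.
Proof.
rewrite /weight l1norm_delta dot_delta; have := c_le1 i.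
by have := delta_le; lra.
Qed.

Lemma l1norm_embed v : l1norm (embed R v) = (nrm1 v)%:R.
Proof.
rewrite /l1norm /nrm1 natr_sum; apply: eq_bigr => i _.
by rewrite mxE -intr_norm -natr_absz.
Qed.

Lemma embed_tgt e : embed R (edge_tgt e) = embed R (edge_src e) + delta_mx 0 e.2.
Proof.
by apply/rowP => i; rewrite !mxE intrD; case: (_ && _).
Qed.

Lemma weight_other v e : incident v e ->
  `|weight (embed R (other e v)) - weight (embed R v)| <= 2.
Proof.
have [WD WZ _] := is_norm_weight.
have H1 : weight (embed R (edge_tgt e)) <= weight (embed R (edge_src e)) + 2.
  rewrite embed_tgt; apply: le_trans (WD _ _) _; rewrite lerD2l.
  exact: weight_delta.
have H2 : weight (embed R (edge_src e)) <= weight (embed R (edge_tgt e)) + 2.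
  rewrite -{1}[embed R (edge_src e)](addrK (delta_mx 0 e.2)) -embed_tgt.
  apply: le_trans (WD _ _) _; rewrite lerD2l -scaleN1r WZ normrN1 mul1r.
  exact: weight_delta.
rewrite /incident /other; case: (eqVneq v (edge_src e)) => [->|_] /=.
  by move=> _; rewrite ler_norml; lra.
by move=> /eqP ->; rewrite ler_norml; lra.
Qed.

Lemma dot_other v e : incident v e ->
  `|dot (embed R (other e v)) c - dot (embed R v) c| <= 1.
Proof.
have H : `|dot (embed R (edge_tgt e)) c - dot (embed R (edge_src e)) c| <= 1.
  by rewrite embed_tgt dotD dot_delta addrAC subrr add0r.
rewrite /incident /other; case: (eqVneq v (edge_src e)) => [->|_] //=.
by move=> /eqP ->; rewrite distrC.
Qed.

Lemma weight_midpoint v e : incident v e -> weight (midpoint R e) <=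
  2^-1 * (weight (embed R v) + weight (embed R (other e v))).
Proof.
have [WD WZ _] := is_norm_weight.
have H : weight (midpoint R e) <= 2^-1 *
    (weight (embed R (edge_src e)) + weight (embed R (edge_tgt e))).
  by rewrite WZ ger0_norm ?invr_ge0 // ler_pM2l ?invr_gt0.
rewrite /incident /other; case: (eqVneq v (edge_src e)) => [->|_] //=.
by move=> /eqP ->; rewrite [X in _ * X]addrC.
Qed.

(** One coordinate of the midpoint is a half-integer. *)
Lemma weight_midpoint_gt0 e : 0 < weight (midpoint R e).
Proof.
rewrite lt_neqAle weight_ge0 andbT eq_sym; apply/eqP.
have [_ _ W0] := is_norm_weight.
move=> /W0/rowP/(_ e.2); rewrite /midpoint embed_tgt !mxE !eqxx /= => /eqP.
rewrite mulf_eq0 invr_eq0 pnatr_eq0 /= addrA -intrD -[1]/(1%:~R) -intrD intr_eq0 -addrA.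
by rewrite (negPf (addz_succ_neq0 _)).
Qed.

Definition sgb b : R := if b then 1 else -1.

Lemma embed_shift b v : embed R (shift i0 b v) = embed R v + sgb b *: delta_mx 0 i0.
Proof.
apply/rowP => i; rewrite /shift /sgb; case: b; rewrite !mxE eqxx /=;
  by case: (i == i0); rewrite /= ?mulr1n ?mulr0n ?mulr1 ?mulr0 ?subr0 ?addr0 ?intrD.
Qed.

Lemma midpoint_ray_edge b v :
  midpoint R (ray_edge i0 b v) = embed R v + (2^-1 * sgb b) *: delta_mx 0 i0.
Proof.
rewrite /midpoint embed_tgt.
have -> : edge_src (ray_edge i0 b v) = if b then v else v - delta_mx 0 i0.
  by case: b.
have -> : (ray_edge i0 b v).2 = i0 by case: b.
have half (x : 'rV[R]_d) : 2^-1 *: (x + x) = x.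
  by rewrite -mulr2n -[x *+ 2]scaler_nat scalerA mulVf ?scale1r.
have := embed_shift b v; rewrite /shift /sgb; case: b => [_|->].
  by rewrite mulr1 addrA scalerDr half.
by rewrite scaleN1r subrK addrAC scalerDr half mulrN1 scalerN scaleNr.
Qed.

(** The sign [b] moves [v] away from the hyperplane where [dot _ c] vanishes. *)
Definition outward b v : bool := 0 <= sgb b * c 0 i0 * dot (embed R v) c.

Lemma exists_outward v : exists b, outward b v.
Proof.
have [H|H] := leP 0 (c 0 i0 * dot (embed R v) c).
  by exists true; rewrite /outward /sgb mul1r.
by exists false; rewrite /outward /sgb mulN1r mulNr oppr_ge0 ltW.
Qed.

Lemma outward_shift b v : outward b v -> outward b (shift i0 b v).
Proof.
rewrite /outward embed_shift dotD dotZ dot_delta => H.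
by rewrite mulrDr addr_ge0 // -expr2 sqr_ge0.
Qed.

Lemma weight_outward b v (t : R) : outward b v -> 0 <= t ->
  weight (embed R v) + t / 2 <=
  weight (embed R v + (t * sgb b) *: delta_mx 0 i0).
Proof.
rewrite /outward => out t0; rewrite /weight dotD dotZ dot_delta.
have s1 : `|sgb b| = 1 by rewrite /sgb; case: b {out}; rewrite ?normrN1 ?normr1.
have cs1 : `|sgb b * c 0 i0| = 1 by rewrite normrM s1 c_i0 mulr1.
have -> : `|dot (embed R v) c + t * sgb b * c 0 i0| = `|dot (embed R v) c| + t.
  rewrite -[t * _ * _]mulrA; move: out cs1; move: (sgb b * c 0 i0) (dot _ c) => u x out.
  have [u0|u0] := leP 0 u.
    rewrite (ger0_norm u0) => u1; move: out; rewrite u1 mul1r mulr1 => x0.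
    by rewrite !ger0_norm // addr_ge0.
  rewrite (ltr0_norm u0) => u1; have uE : u = -1 by rewrite -u1 opprK.
  move: out; rewrite uE mulN1r oppr_ge0 mulrN1 => x0.
  by rewrite (ler0_norm x0) ler0_norm ?opprB; lra.
have H : l1norm (embed R v) <=
    l1norm (embed R v + (t * sgb b) *: delta_mx 0 i0) + t.
  rewrite -{1}[embed R v](addrK ((t * sgb b) *: delta_mx 0 i0)).
  apply: le_trans (l1normD _ _) _; rewrite lerD2l -scaleNr l1normZ l1norm_delta.
  by rewrite normrN normrM s1 (ger0_norm t0) !mulr1.
rewrite -(ler_pM2l delta_gt0) mulrDr in H.
have : delta * t <= 2^-1 * t by rewrite ler_wpM2r.
lra.
Qed.

Lemma outward_iter b v n : outward b v -> outward b (iter n (shift i0 b) v).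
Proof. by move=> out; elim: n => //= n IH; exact: outward_shift. Qed.

Lemma weight_iter b v n : outward b v ->
  weight (embed R v) + n%:R / 2 <= weight (embed R (iter n (shift i0 b) v)).
Proof.
move=> out; elim: n => [|n IH]; first by rewrite mul0r addr0.
have := weight_outward (outward_iter n out) ler01.
rewrite !mul1r -embed_shift -iterS; apply: le_trans.
by rewrite -natr1 mulrDl mul1r addrA lerD2r.
Qed.

Lemma weight_ray b v n e : outward b v -> e \in ray i0 b v n ->
  weight (embed R v) <= weight (midpoint R e).
Proof.
elim: n v => //= n IH v out; rewrite inE => /orP[/eqP ->|/(IH _ (outward_shift out))].
  rewrite midpoint_ray_edge.
  by apply: le_trans (weight_outward out _); rewrite ?lerDl ?invr_ge0 ?divr_ge0.
apply: le_trans; have := @weight_iter b v 1 out; apply: le_trans.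
by rewrite lerDl divr_ge0.
Qed.

Lemma weight_walk v s x : walk v s -> x \in v :: trace v s ->
  `|weight (embed R x) - weight (embed R (endp v s))| <= 2 * (size s)%:R.
Proof.
elim: s v x => [|e s IH] v x /=.
  by rewrite inE => _ /eqP ->; rewrite subrr normr0 mulr0.
move=> /andP[ve ws]; have H := weight_other ve.
have H' y := IH _ y ws; rewrite -[(size s).+1%:R]natr1 mulrDr mulr1.
rewrite inE => /orP[/eqP ->|/H' /le_trans]; last first.
  by apply; rewrite lerDl.
have := H' (other e v) (mem_head _ _).
move: H; rewrite !ler_norml; lra.
Qed.

Lemma weight_walk_midpoint v s e : walk v s -> e \in s ->
  weight (midpoint R e) <= weight (embed R (endp v s)) + 2 * (size s)%:R.
Proof.
move=> ws; elim: s v ws => //= f s IH v /andP[vf ws].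
have wfs : walk v (f :: s) by rewrite /= vf.
rewrite inE => /orP[/eqP ->|es]; last first.
  by apply: le_trans (IH _ ws es) _; rewrite lerD2l ler_pM2l // ler_nat.
apply: le_trans (weight_midpoint vf) _.
have h1 := weight_walk wfs (mem_head _ _).
have h2 : other f v \in v :: trace v (f :: s) by rewrite /= !inE eqxx orbT.
have {h2} h2 := weight_walk wfs h2.
by move: h1 h2; rewrite /= !ler_norml; lra.
Qed.

Lemma weight_midpoint_max v s e (y : R) : walk v s -> e \in s ->
  (forall x, x \in v :: trace v s -> weight (embed R x) <= y) ->
  weight (midpoint R e) <= y.
Proof.
elim: s v => //= f s IH v /andP[vf ws]; rewrite inE => /orP[/eqP ->|es] H.
  apply: le_trans (weight_midpoint vf) _.
  have := H v (mem_head _ _); have := H (other f v).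
  by rewrite !inE eqxx orbT => /(_ isT); lra.
by apply: (IH _ ws es) => x xin; apply: H; rewrite inE xin orbT.
Qed.

End Weight.

(** * The cost of reaching infinity and the slow region *)

Lemma half_bound (R : realType) n : [/\ (n%:R <= 2 * n./2%:R + 1 :> R),
  (2 * n./2%:R <= n%:R :> R) & (n./2 <= n)%N].
Proof.
by split; rewrite -?natrM ?natr1 ?ler_nat; have := odd_double_half n; lia.
Qed.

Lemma pred_pow2S n : ((2 ^ n.+1).-1 = (2 ^ n).-1 + 2 ^ n)%N.
Proof. by have := expn_gt0 2 n; rewrite expnS; lia. Qed.

Section Explosiveness.
Context {R : realType} (alpha : R).
Hypothesis alpha_gt1 : 1 < alpha.
Implicit Types x y : R.

(** Up to a constant, the time needed to reach infinity from a point of weight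
[x]: the exponent [1 - alpha] comes from integrating the [- alpha]-th power. *)
Definition escape x : R := x / x `^ alpha.

Lemma escapeE x : 0 < x -> escape x = (x `^ (alpha - 1))^-1.
Proof.
move=> x0; rewrite /escape -(@mulr_powRB1 _ x) ?ltW //; last exact: lt_trans alpha_gt1.
by rewrite invfM mulVKf ?gt_eqF.
Qed.

Lemma escape_gt0 x : 0 < x -> 0 < escape x.
Proof. by move=> x0; rewrite escapeE // invr_gt0 powR_gt0. Qed.

Lemma escapeM x y : 0 <= x -> 0 <= y -> escape (x * y) = escape x * escape y.
Proof. by move=> x0 y0; rewrite /escape powRM // invfM mulrACA. Qed.

Lemma escape_le x y : 0 < x -> x <= y -> escape y <= escape x.
Proof.
move=> x0 xy; have y0 : 0 < y by exact: lt_le_trans xy.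
rewrite !escapeE // lef_pV2 ?posrE ?powR_gt0 //.
by apply: ge0_ler_powR => //; rewrite ?nnegrE ?subr_ge0; exact: ltW.
Qed.

Lemma escape1 : escape 1 = 1.
Proof. by rewrite /escape powR1 divr1. Qed.

Lemma escape2_lt1 : escape 2 < 1.
Proof.
rewrite escapeE // invf_lt1 ?powR_gt0 //.
have := @gt0_ltr_powR R (alpha - 1); rewrite subr_gt0 => /(_ alpha_gt1 1 2).
by rewrite powR1 !nnegrE; apply => //; rewrite ltr1n.
Qed.

Lemma escape2X n : escape (2 ^+ n) = escape 2 ^+ n.
Proof.
by elim: n => [|n IH]; rewrite ?expr0 ?escape1 // !exprS escapeM ?IH // exprn_ge0.
Qed.

Lemma escape_small (eps : R) : 0 < eps -> exists m, (2 < m)%N /\ escape 2 ^+ m < eps.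
Proof.
move=> e0; have e2 : 0 < escape 2 by exact: escape_gt0.
have : `|escape 2| < 1 by rewrite gtr0_norm // escape2_lt1.
move=> /cvg_expr /cvgr0Pnorm_lt /(_ _ e0) [n _ Hn].
exists (maxn n 3); split; first by rewrite leq_maxr.
have := Hn (maxn n 3) (leq_maxl _ _).
by rewrite /= gtr0_norm // exprn_gt0.
Qed.

End Explosiveness.

Section Costs.
Context {R : realType} {d : nat} (c : 'rV[R]_d) (i0 : 'I_d) (delta : R).
Hypothesis c_le1 : forall i, `|c 0 i| <= 1.
Hypothesis c_i0 : `|c 0 i0| = 1.
Hypotheses (delta_gt0 : 0 < delta) (delta_le : delta <= 2^-1).
Variables (alpha tlo thi : R) (M : nat).
Hypotheses (alpha_gt1 : 1 < alpha) (tlo_gt0 : 0 < tlo) (thi_gt0 : 0 < thi).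
Hypothesis M_ge : 2 / delta + 5 <= M%:R.
Variable W : edge d -> R.
Hypothesis W_gt0 : forall e, 0 < W e.

Local Notation wt z := (weight c delta z).
Local Notation wtv v := (weight c delta (embed R v)).
Local Notation rate e := (weight c delta (midpoint R e) `^ alpha).
Local Notation lin v := (dot (embed R v) c).
Implicit Types (v : 'rV[int]_d) (e : edge d) (s : seq (edge d)).

Variable nH : nat.
Hypothesis linear : forall n v s, (nH <= n)%N -> (nrm1 v <= M * n)%N ->
    simple v s -> size s = n ->
    tlo * n%:R <= \sum_(e <- s) rate e * W e <= thi * n%:R.

Let alpha_ge0 : 0 <= alpha.
Proof. by apply: ltW; exact: lt_trans alpha_gt1. Qed.

Let rate_le e (y : R) : wt (midpoint R e) <= y -> rate e <= y `^ alpha.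
Proof.
move=> H; have w0 := weight_ge0 c delta_gt0 (midpoint R e).
by apply: ge0_ler_powR => //; rewrite nnegrE //; exact: le_trans H.
Qed.

Lemma path_time_lower v s (y : R) : 0 < y -> (nH <= size s)%N ->
  (nrm1 v <= M * size s)%N -> simple v s ->
  (forall e, e \in s -> wt (midpoint R e) <= y) ->
  tlo * (size s)%:R / y `^ alpha <= path_time W s.
Proof.
move=> y0 ns vn ss H; rewrite ler_pdivrMr ?powR_gt0 //.
have /andP[+ _] := linear ns vn ss erefl; move=> /le_trans; apply.
rewrite /path_time mulr_suml big_seq_cond [leRHS]big_seq_cond.
apply: ler_sum => e /andP[es _]; rewrite mulrC; apply: ler_wpM2l; first exact: ltW.
exact: rate_le (H e es).
Qed.

Lemma path_time_upper v s (y : R) : 0 < y -> (nH <= size s)%N ->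
  (nrm1 v <= M * size s)%N -> simple v s ->
  (forall e, e \in s -> y <= wt (midpoint R e)) ->
  path_time W s <= thi * (size s)%:R / y `^ alpha.
Proof.
move=> y0 ns vn ss H; rewrite ler_pdivlMr ?powR_gt0 //.
have /andP[_] := linear ns vn ss erefl; apply: le_trans.
rewrite /path_time mulr_suml big_seq_cond [leRHS]big_seq_cond.
apply: ler_sum => e /andP[es _]; rewrite mulrC; apply: ler_wpM2r; first exact: ltW.
have He := H e es; apply: ge0_ler_powR => //; rewrite nnegrE ?ltW //.
exact: lt_le_trans He.
Qed.

Let z : R := escape alpha 2.
Let z_gt0 : 0 < z. Proof. exact: escape_gt0. Qed.
Let z_lt1 : z < 1. Proof. exact: escape2_lt1. Qed.

(** The denominator sums the geometric series of the costs of the dyadic blocks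
of a ray. *)
Definition ray_const : R := 4 * thi * escape alpha 2^-1 / (1 - escape alpha 2).

Lemma ray_const_gt0 : 0 < ray_const.
Proof.
by rewrite /ray_const divr_gt0 ?subr_gt0 // !mulr_gt0 // escape_gt0 ?invr_gt0.
Qed.

Lemma nrm1_le_weight v : (nrm1 v)%:R <= wtv v / delta.
Proof.
by rewrite ler_pdivlMr // mulrC -l1norm_embed; exact: l1norm_le_weight.
Qed.

(** Along a ray the weight grows linearly, so the dyadic blocks of the ray have
costs that decrease geometrically, the exponent being larger than [1]. *)
Lemma ray_time b v (n0 J : nat) : outward c i0 b v -> (nH <= n0)%N ->
  0 < wtv v -> wtv v <= n0%:R -> n0%:R <= 2 * wtv v ->
  path_time W (ray i0 b v (n0 * (2 ^ J).-1)) <=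
    4 * thi * escape alpha 2^-1 * escape alpha (wtv v) * ((1 - z ^+ J) / (1 - z)).
Proof.
move=> out nn0 s0 sn0 n0s; set s := wtv v in s0 sn0 n0s *.
set a := 4 * thi * _ * _.
have z1 : 1 - z != 0 by rewrite subr_eq0 gt_eqF.
elim: J => [|J IH].
  by rewrite /= muln0 /= expr0 subrr mul0r mulr0 /path_time big_nil.
have -> : (n0 * (2 ^ J.+1).-1 = n0 * (2 ^ J).-1 + n0 * 2 ^ J)%N.
  by rewrite -mulnDr pred_pow2S.
rewrite ray_cat path_time_cat.
have -> : (1 - z ^+ J.+1) / (1 - z) = (1 - z ^+ J) / (1 - z) + z ^+ J.
  by rewrite exprS; field.
rewrite mulrDr lerD //.
set k := (n0 * (2 ^ J).-1)%N; set u := iter k _ _.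
have kR : k%:R = n0%:R * (2 ^+ J - 1) :> R.
  by rewrite /k natrM -subn1 natrB ?expn_gt0 // natrX.
have su : s / 2 * 2 ^+ J <= wtv u.
  apply: le_trans (weight_iter c_i0 delta_gt0 delta_le k out); rewrite -/s kR.
  have p1 : 1 <= 2 ^+ J :> R by rewrite exprn_ege1 // ler1n.
  have : s * (2 ^+ J - 1) <= n0%:R * (2 ^+ J - 1) by rewrite ler_wpM2r // subr_ge0.
  by move: p1; move: (2 ^+ J) => p; have := s0; lra.
have s20 : 0 < s / 2 by rewrite divr_gt0.
have p0 : 0 < 2 ^+ J :> R by rewrite exprn_gt0.
apply: le_trans (path_time_upper (v := u) (y := s / 2 * 2 ^+ J) _ _ _ _ _) _.
- by rewrite mulr_gt0.
- by rewrite size_ray; apply: leq_trans nn0 _; rewrite leq_pmulr ?expn_gt0.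
- have uk : (nrm1 u <= nrm1 v + k)%N.
    have := nrm1_endp (walk_ray i0 b v k).
    by rewrite endp_ray size_ray.
  rewrite size_ray -(ler_nat R); apply: (@le_trans _ _ (nrm1 v + k)%:R).
    by rewrite ler_nat.
  rewrite natrD kR natrM natrM natrX.
  have v1 : (nrm1 v)%:R <= n0%:R / delta.
    apply: le_trans (nrm1_le_weight v) _.
    by rewrite ler_wpM2r // invr_ge0 ltW.
  have p1 : 1 <= 2 ^+ J :> R by rewrite exprn_ege1 // ler1n.
  have n0p : 0 <= n0%:R :> R by [].
  have d0 : 0 <= delta^-1 by rewrite invr_ge0 ltW.
  have h1 : n0%:R / delta <= n0%:R * 2 ^+ J / delta.
    by rewrite ler_wpM2r // ler_peMr.
  have h2 : (2 / delta + 5) * (n0%:R * 2 ^+ J) <= M%:R * (n0%:R * 2 ^+ J).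
    by rewrite ler_wpM2r // mulr_ge0 // ltW.
  have h3 : 0 <= n0%:R * 2 ^+ J / delta by rewrite !mulr_ge0 // ltW.
  have h4 : 0 <= n0%:R * 2 ^+ J :> R by rewrite mulr_ge0 // ltW.
  move: h1 h2 h3 h4 v1 n0p; rewrite [2 / delta]mulrC mulrDl.
  rewrite [n0%:R * 2 ^+ J / delta]mulrC; move: (delta^-1) => D.
  move: (2 ^+ J) => p; move: (nrm1 v)%:R => t; move: n0%:R => q.
  lra.
- exact: simple_ray.
- move=> e es; apply: le_trans su _.
  exact: (weight_ray c_i0 delta_gt0 delta_le (outward_iter _ out) es).
rewrite size_ray natrM natrX.
have -> : a * z ^+ J = 4 * thi * (escape alpha (s / 2 * 2 ^+ J)).
  rewrite escapeM ?ltW // escapeM ?invr_ge0 // ?ltW // escape2X // -/z /a.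
  by ring.
rewrite /escape [leRHS]mulrA; apply: ler_wpM2r; first by rewrite invr_ge0 powR_ge0.
have -> : 4 * thi * (s / 2 * 2 ^+ J) = thi * (2 * s * 2 ^+ J) by field.
rewrite ler_pM2l //; apply: (@le_trans _ _ (2 * s * 2 ^+ J)).
  by rewrite ler_pM2r.
by [].
Qed.

Lemma ray_cost v : nH.+1%:R <= wtv v -> forall n, exists s,
  [/\ (n <= size s)%N, walk v s, uniq s &
      path_time W s <= ray_const * escape alpha (wtv v)].
Proof.
move=> Hs n; have [b out] := exists_outward c i0 v.
have s1 : 1 <= wtv v by apply: le_trans Hs; rewrite ler1n.
have s0 : 0 < wtv v by exact: lt_le_trans s1.
pose n0 := (Num.truncn (wtv v)).+1.
have n0gt : wtv v < n0%:R by exact: truncnS_gt.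
have n0le : n0%:R <= wtv v + 1.
  by rewrite /n0 -natr1 lerD2r truncn_le ltW.
have nHn0 : (nH <= n0)%N by rewrite -(ler_nat R); move: Hs; rewrite -natr1; lra.
exists (ray i0 b v (n0 * (2 ^ n).-1)); split.
- rewrite size_ray; apply: (@leq_trans (2 ^ n).-1); last by rewrite leq_pmull.
  by rewrite -ltnS prednK ?expn_gt0 // ltn_expl.
- exact: walk_ray.
- exact: simple_uniq (simple_ray _ _ _ _).
apply: le_trans (ray_time n out nHn0 s0 (ltW n0gt) _) _; first by lra.
have E0 : 0 < escape alpha (wtv v) by exact: escape_gt0.
have E2 : 0 < escape alpha 2^-1 by apply: escape_gt0; rewrite ?invr_gt0.
rewrite /ray_const [leRHS]mulrAC -/z ler_wpM2l //.
  apply: mulr_ge0 (ltW E0); apply: mulr_ge0 (ltW E2).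
  exact: mulr_ge0 (ltW thi_gt0).
rewrite ler_pdivrMr ?subr_gt0 // mulVf ?subr_eq0 ?gt_eqF //.
by rewrite gerBl exprn_ge0 // ltW.
Qed.

Lemma tau_infty_finite : exists tau, tau_infty W = tau%:E.
Proof.
have [b out] := exists_outward c i0 (0 : 'rV[int]_d).
set n := (nH.+1 * 2)%N; pose v := iter n (shift i0 b) (0 : 'rV[int]_d).
have Hv : nH.+1%:R <= wtv v.
  apply: le_trans (weight_iter c_i0 delta_gt0 delta_le n out).
  by rewrite /n natrM mulfK // lerDr weight_ge0.
have lo : (0 <= tau_infty W)%E.
  by apply/ereal_infP => _ [t [t0 _] <-]; rewrite lee_fin ltW.
have hi := tau_infty_le W_gt0 (walk_ray i0 b 0 n) (b := ray_const * escape alpha (wtv v)).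
rewrite endp_ray -/v in hi; have {}hi := hi (ray_cost Hv).
exists (fine (tau_infty W)); rewrite fineK // fin_numE.
by case: (tau_infty W) lo hi.
Qed.

Local Notation V := (cluster_vertices W (tau_infty W)).

(** Otherwise, leaving the path at [endp 0 s1] along a ray would reach infinity
before time [tau]. *)
Lemma remaining_time s1 s2 tau : tau_infty W = tau%:E -> walk 0 s1 ->
  path_time W (s1 ++ s2) <= tau -> nH.+1%:R <= wtv (endp 0 s1) ->
  path_time W s2 <= ray_const * escape alpha (wtv (endp 0 s1)).
Proof.
move=> tauE ws1 st Hu; have := tau_infty_le W_gt0 ws1 (ray_cost Hu).
rewrite tauE lee_fin => H; move: st; rewrite path_time_cat; lra.
Qed.

Variable m : nat.
Hypothesis m_gt2 : (2 < m)%N.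
Local Notation K := (2 ^+ m : R).
Hypothesis far_cheap : ray_const * escape alpha K < tlo / 8 * escape alpha 4.
Hypothesis delta_small :
  ray_const * escape alpha 2^-1 < tlo / (4 * K * delta) * escape alpha K.

(** Let [v] have [nrm1 v = r] and lie in the slow region, where the weight is
of order [delta * r], and follow a geodesic to [v]. If it has visited a vertex
of weight [2 ^ m * delta * r], then from there infinity was much closer than
[v], since the last [delta * r] edges are still slow. If not, its last [r / 2]
edges are all slow, and for small [delta] they cost more than moving sideways
along a ray out of the slow region and on to infinity. Both contradict
[remaining_time]. *)
Lemma slow_not_reached : exists N0, forall v, V v -> (N0 <= nrm1 v)%N ->
  delta * (nrm1 v)%:R < `|lin v|.
Proof.
have [tau tauE] := tau_infty_finite.
exists (Num.truncn (2 * nH.+1%:R / delta)).+1 => v Vv Nv.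
rewrite ltNge; apply/negP => slow.
set r := nrm1 v in Nv slow; set y := delta * r%:R in slow.
have K8 : 8 <= K.
  have -> : 8 = 2 ^+ 3 :> R by ring.
  by apply: ler_weXn2l => //; rewrite ler1n.
have y_ge : 2 * nH.+1%:R <= y.
  rewrite /y [leRHS]mulrC -ler_pdivrMr //; apply: ltW.
  by apply: lt_le_trans (truncnS_gt _) _; rewrite ler_nat.
have nH1 : 1 <= nH.+1%:R :> R by rewrite ler1n.
have nHR : nH%:R + 1 = nH.+1%:R :> R by rewrite natr1.
have y0 : 0 < y by lra.
have wv : wtv v <= 2 * y.
  by rewrite /weight l1norm_embed -/r -/y; lra.
have Ey : 0 < escape alpha y by exact: escape_gt0.
have Mn n : (y <= 2 * n%:R) -> (r + n <= M * n)%N.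
  move=> yn; rewrite -(ler_nat R) natrD natrM.
  have h1 : r%:R <= 2 * n%:R / delta by rewrite ler_pdivlMr // mulrC.
  have h2 : (2 / delta + 5) * n%:R <= M%:R * n%:R by rewrite ler_wpM2r.
  have h3 : 0 <= n%:R :> R by [].
  by move: h1 h2; move: (delta^-1) => D; lra.
have [s [ss sv st]] := geodesic W_gt0 tauE Vv.
have ws : walk 0 s by case/andP: ss.
have rs : (r <= size s)%N by have := nrm1_endp ws; rewrite nrm10 sv.
have [[x [xin Kx]]|nofar] :=
  pselect (exists x, x \in 0 :: trace 0 s /\ K * y <= wtv x).
- have [s1 [s2 [sE ux]]] := mem_trace xin.
  have ws1 : walk 0 s1 by move: ws; rewrite sE walk_cat => /andP[].
  have ws2 : walk x s2 by move: ws; rewrite sE walk_cat ux => /andP[].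
  have es2 : endp x s2 = v by rewrite -sv sE endp_cat ux.
  have x_ge : nH.+1%:R <= wtv (endp 0 s1).
    by rewrite ux; apply: le_trans Kx; nra.
  rewrite sE in st ss.
  have := remaining_time tauE ws1 st x_ge; rewrite ux => Hs2.
  have {}Hs2 : path_time W s2 <= ray_const * escape alpha (K * y).
    apply: le_trans Hs2 _; rewrite ler_wpM2l ?(ltW ray_const_gt0) //.
    by apply: escape_le => //; rewrite mulr_gt0 // exprn_gt0.
  set n := Num.truncn y.
  have ny : n%:R <= y by rewrite truncn_le ltW.
  have yn1 : y < n%:R + 1 by rewrite natr1 truncnS_gt.
  have ns2 : (n <= size s2)%N.
    have := weight_walk c_le1 delta_gt0 delta_le ws2 (mem_head x _).
    rewrite es2 ler_norml => /andP[_ H]; rewrite -(ler_nat R).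
    by have H8 : 8 * y <= K * y by [rewrite ler_pM2r]; lra.
  pose a := take (size s2 - n) s2; pose bs := drop (size s2 - n) s2.
  have s2E : s2 = a ++ bs by rewrite cat_take_drop.
  have szb : size bs = n by rewrite size_drop subKn.
  have sb : simple (endp x a) bs.
    by apply: simple_catr; rewrite -s2E -ux; exact: simple_catr ss.
  have wb : walk (endp x a) bs by case/andP: sb.
  have eb : endp (endp x a) bs = v by rewrite -endp_cat -s2E.
  have nHn : (nH <= size bs)%N by rewrite szb -(ler_nat R); lra.
  have y4 : 0 < 4 * y by rewrite mulr_gt0.
  have := path_time_lower y4 nHn _ sb.
  have -> : (nrm1 (endp x a) <= M * size bs)%N.
    have := nrm1_start wb; rewrite eb szb => /leq_trans; apply; apply: Mn; lra.
  move=> /(_ isT) lower; have {lower} lower := lower _.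
  have {lower} : tlo * (size bs)%:R / (4 * y) `^ alpha <= path_time W bs.
    apply: lower => e ebs; have := weight_walk_midpoint c_le1 delta_gt0 delta_le wb ebs.
    by rewrite eb szb => /le_trans; apply; lra.
  apply/negP; rewrite -ltNge.
  apply: (@le_lt_trans _ _ (path_time W s2)).
    by rewrite s2E path_time_cat lerDr path_time_ge0.
  apply: le_lt_trans Hs2 _.
  apply: (@lt_le_trans _ _ (tlo / 8 * escape alpha 4 * escape alpha y)).
    by rewrite escapeM ?ltW ?exprn_gt0 // mulrA ltr_pM2r.
  rewrite -[leLHS]mulrA -escapeM ?(ltW y0) // /escape [leLHS]mulrA.
  apply: ler_wpM2r; first by rewrite invr_ge0 powR_ge0.
  rewrite szb; have -> : tlo / 8 * (4 * y) = tlo * (y / 2) by field.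
  by rewrite ler_pM2l //; lra.
- have {}nofar x : x \in 0 :: trace 0 s -> wtv x <= K * y.
    by move=> xin; rewrite leNgt; apply/negP => /ltW H; apply: nofar; exists x.
  set n := r./2; have [n2 n2' nr'] := half_bound R r; rewrite -/n in n2 n2' nr'.
  have ry : 2 * y <= r%:R.
    rewrite /y mulrA ler_piMl //; have := delta_le; lra.
  have nr : (n <= size s)%N := leq_trans nr' rs.
  pose a := take (size s - n) s; pose bs := drop (size s - n) s.
  have sE : s = a ++ bs by rewrite cat_take_drop.
  have szb : size bs = n by rewrite size_drop subKn.
  rewrite sE in st ss.
  have wa : walk 0 a by move: ws; rewrite sE walk_cat => /andP[].
  have sb : simple (endp 0 a) bs by exact: simple_catr ss.
  have wb : walk (endp 0 a) bs by case/andP: sb.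
  have eb : endp (endp 0 a) bs = v by rewrite -endp_cat -sE.
  have nHn : (nH <= size bs)%N by rewrite szb -(ler_nat R); lra.
  have xr : r%:R <= (nrm1 (endp 0 a))%:R + n%:R :> R.
    by rewrite -natrD ler_nat; have := nrm1_endp wb; rewrite eb szb.
  have wx : 2^-1 * y <= wtv (endp 0 a).
    apply: le_trans (l1norm_le_weight _ _ _); rewrite l1norm_embed /y mulrCA.
    rewrite ler_pM2l //; lra.
  have x_ge : nH.+1%:R <= wtv (endp 0 a) by apply: le_trans wx; lra.
  have := remaining_time tauE wa st x_ge => Hb.
  have y20 : 0 < 2^-1 * y by rewrite mulr_gt0 ?invr_gt0.
  have {}Hb : path_time W bs <= ray_const * escape alpha (2^-1 * y).
    apply: le_trans Hb _; rewrite ler_wpM2l ?(ltW ray_const_gt0) //.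
    exact: escape_le.
  have yK : 0 < K * y by rewrite mulr_gt0 // exprn_gt0.
  have := path_time_lower yK nHn _ sb.
  have -> : (nrm1 (endp 0 a) <= M * size bs)%N.
    have := nrm1_start wb; rewrite eb szb => /leq_trans; apply; apply: Mn; lra.
  move=> /(_ isT) lower; have {lower} lower := lower _.
  have {lower} : tlo * (size bs)%:R / (K * y) `^ alpha <= path_time W bs.
    apply: lower => e ebs; apply: (weight_midpoint_max delta_gt0 wb ebs) => x xin.
    apply: nofar; rewrite sE trace_cat -cat_cons mem_cat.
    move: xin; rewrite inE => /orP[/eqP ->|->]; last by rewrite orbT.
    by rewrite mem_endp.
  apply/negP; rewrite -ltNge; apply: le_lt_trans Hb _.
  apply: (@lt_le_trans _ _ (tlo / (4 * K * delta) * escape alpha K * escape alpha y)).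
    by rewrite escapeM ?invr_ge0 ?(ltW y0) // mulrA ltr_pM2r.
  rewrite -[leLHS]mulrA -escapeM ?exprn_ge0 ?(ltW y0) // /escape [leLHS]mulrA.
  apply: ler_wpM2r; first by rewrite invr_ge0 powR_ge0.
  have -> : tlo / (4 * K * delta) * (K * y) = tlo * (r%:R / 4).
    by rewrite /y; field; rewrite expf_neq0 //= gt_eqF.
  by rewrite szb ler_pM2l //; lra.
Qed.

End Costs.

(** * Norms and cones *)

Lemma ae_forall_countable {R : realType} {disp : measure_display}
    {T : measurableType disp} (mu : {measure set T -> \bar R}) (J : countType)
    (Q : J -> T -> Prop) :
  (forall j, {ae mu, forall w, Q j w}) -> {ae mu, forall w, forall j, Q j w}.
Proof.
move=> H; have : {ae mu, forall w, forall n,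
    if unpickle n is Some j then Q j w else True}.
  by apply: ae_foralln => n; case: unpickle => [j|]; [exact: H|exact: aeW].
by apply: filterS => w Hw j; have := Hw (pickle j); rewrite pickleK.
Qed.

Section Norms.
Context {R : realType} {d : nat}.
Implicit Types x z : 'rV[R]_d.

Lemma coord_le_enorm x i : `|x 0 i| <= enorm x.
Proof.
rewrite /enorm -sqrtr_sqr ler_wsqrtr // /dot (bigD1 i) //= -expr2 lerDl.
by apply: sumr_ge0 => j _; rewrite -expr2 sqr_ge0.
Qed.

Lemma enorm_le_l1norm z : enorm z <= l1norm z.
Proof.
rewrite -(ger0_norm (l1norm_ge0 z)) /enorm -sqrtr_sqr ler_wsqrtr // expr2.
rewrite {1}/l1norm mulr_suml; apply: ler_sum => i _.
apply: le_trans (ler_norm _) _; rewrite normrM; apply: ler_wpM2l => //.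
by rewrite /l1norm (bigD1 i) //= lerDl; apply: sumr_ge0.
Qed.

Variable mu : 'rV[R]_d -> R.
Hypothesis hmu : is_norm mu.

Lemma norm0 : mu 0 = 0.
Proof. by have := is_normZ hmu 0 0; rewrite scale0r normr0 mul0r. Qed.

Lemma norm_ge0 x : 0 <= mu x.
Proof.
have := is_normD hmu x (- x); rewrite subrr norm0 -scaleN1r (is_normZ hmu).
by rewrite normrN1 mul1r; lra.
Qed.

Lemma norm_le_coord z : mu z <= \sum_(i < d) `|z 0 i| * mu (delta_mx 0 i).
Proof.
rewrite {1}[z]row_sum_delta.
have : forall r : seq 'I_d, mu (\sum_(j <- r) z 0 j *: delta_mx 0 j) <=
    \sum_(j <- r) `|z 0 j| * mu (delta_mx 0 j).
  elim=> [|j r IH]; first by rewrite !big_nil norm0.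
  rewrite !big_cons; apply: le_trans (is_normD hmu _ _) _.
  by rewrite (is_normZ hmu) lerD2l.
exact.
Qed.

Lemma interior_unit_ball : ([set z | mu z <= 1])^° 0.
Proof.
pose S := \sum_(i < d) mu (delta_mx 0 i).
have S0 : 0 <= S by apply: sumr_ge0 => i _; exact: norm_ge0.
apply/nbhs_ballP; exists (S + 1)^-1; first by rewrite /= invr_gt0 ltr_pwDr.
move=> z zS /=; apply: le_trans (norm_le_coord z) _.
apply: (@le_trans _ _ ((S + 1)^-1 * S)).
  rewrite mulr_sumr; apply: ler_sum => i _; apply: ler_wpM2r; first exact: norm_ge0.
  by have [_ /(_ 0 i)] := zS; rewrite /ball /= mxE sub0r normrN => /ltW.
by rewrite mulrC ler_pdivrMr ?mul1r ?lerDl // ltr_pwDr.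
Qed.

End Norms.

Lemma boundary_neq0 {R : realType} {d : nat} (mu : 'rV[R]_d -> R) (x : 'rV[R]_d) :
  is_norm mu -> boundary [set z | mu z <= 1] x -> x != 0.
Proof.
by move=> hmu [_ nint]; apply/eqP => x0; apply: nint; rewrite x0;
  exact: interior_unit_ball.
Qed.

Section Cone.
Context {R : realType} {d : nat} (x0 : 'rV[R]_d) (i0 : 'I_d).
Hypothesis x0i0 : 0 < `|x0 0 i0|.
Variable delta : R.
Hypotheses (delta_gt0 : 0 < delta) (delta_le : delta <= 2^-1).
Local Notation a := `|x0 0 i0|.

(** With this angle [cos (angle / 2) * enorm x0 = delta * a], so that the cone
contains the points whose linear part of the weight exceeds the other part. *)
Definition angle : R := 2 * acos (delta * a / enorm x0).

Let n0 : 0 < enorm x0.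
Proof. exact: lt_le_trans x0i0 (coord_le_enorm _ _). Qed.

Let ratio_gt0 : 0 < delta * a / enorm x0.
Proof. by rewrite divr_gt0 // mulr_gt0. Qed.

Let ratio_lt1 : delta * a / enorm x0 < 1.
Proof.
rewrite ltr_pdivrMr // mul1r.
have h1 := coord_le_enorm x0 i0.
have h2 : delta * a <= 2^-1 * a by rewrite ler_pM2r.
by have := x0i0; lra.
Qed.

Lemma cos_half_angle : cos (angle / 2) = delta * a / enorm x0.
Proof.
rewrite /angle mulrC mulKf // acosK // in_itv /=.
by rewrite (le_trans _ (ltW ratio_gt0)) ?lerN10 // ltW.
Qed.

Lemma angle_range : 0 < angle < pi.
Proof.
have r0 := ratio_gt0; have r1 := ratio_lt1.
have ac0 : 0 < acos (delta * a / enorm x0).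
  by apply: acos_gt0; rewrite r1 andbT (le_trans _ (ltW r0)) // lerN10.
have rI : -1 <= delta * a / enorm x0 <= 1.
  by rewrite (ltW r1) andbT (le_trans _ (ltW r0)) // lerN10.
rewrite /angle mulr_gt0 //= mulrC -ltr_pdivlMr //.
have p0 := pi_gt0 R.
have p2 : (0 <= pi / 2 :> R) && (pi / 2 <= pi :> R).
  by rewrite divr_ge0 ?(ltW p0) // ler_pdivrMr // mulr_natr mulr2n lerDl ltW.
rewrite -ltr_cos ?in_itv /= ?acos_ge0 ?acos_lepi //.
by rewrite cos_pihalf acosK // in_itv.
Qed.

Lemma in_cone z : delta * l1norm z < dot z (a^-1 *: x0) -> cone x0 angle z.
Proof.
move=> H; have H0 : 0 < dot z (a^-1 *: x0).
  by apply: le_lt_trans H; rewrite mulr_ge0 ?l1norm_ge0 // ltW.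
have z0 : z != 0.
  apply/eqP => z0; move: H0; rewrite z0 /dot big1 ?ltxx // => i _.
  by rewrite mxE mul0r.
split => //; rewrite cos_half_angle.
have dZr (b : R) : dot z (b *: x0) = b * dot z x0.
  by rewrite /dot mulr_sumr; apply: eq_bigr => i _; rewrite mxE mulrCA.
rewrite dotZ dZr mulrA; rewrite dZr in H.
have ez : 0 < enorm z.
  have [i zi] : exists i, z 0 i != 0.
    apply/existsP; apply: contraNT z0; rewrite negb_exists => /forallP Hz.
    by apply/eqP/rowP => i; rewrite mxE; have := Hz i; rewrite negbK => /eqP.
  by apply: lt_le_trans (coord_le_enorm z i); rewrite normr_gt0.
have H' : delta * enorm z < a^-1 * dot z x0.
  by apply: le_lt_trans H; rewrite ler_pM2l // enorm_le_l1norm.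
rewrite ltr_pdivlMl // in H'; rewrite ltr_pdivrMr //.
have -> : (enorm z)^-1 / enorm x0 * dot z x0 * enorm x0 = (enorm z)^-1 * dot z x0.
  by field; rewrite !gt_eqF.
by rewrite ltr_pdivlMl //; move: H'; lra.
Qed.

End Cone.

(** * Almost sure properties and conclusion *)

Section Typical.
Context {R : realType} {disp : measure_display} {Omega : measurableType disp}.
Context {P : probability Omega R} {d : nat} (X : edge d -> {RV P >-> R}).
Variable rate : edge d -> R.
Hypotheses (indepX : mutually_independent X).
Hypotheses (rate_gt0 : forall e, 0 < rate e)
  (lawX : forall e, has_exponential_law (X e) (rate e)).

Lemma times_gt0 : {ae P, forall w, forall e, 0 < X e w}.
Proof.
apply: ae_forall_countable => e; exists (X e @^-1` `]-oo, 0]%classic); split.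
- by rewrite -[_ @^-1` _]setTI; exact: measurable_funP.
- apply/eqP; rewrite eq_le measure_ge0 andbT.
  by apply: le_trans (exponential_le (rate_gt0 e) (lawX e) _) _; rewrite ?mulr0.
- by move=> w /= /negP; rewrite -leNgt in_itv.
Qed.

(** The two extensions of [r] leave from the same vertex. A self-avoiding path
that leaves it through [e'] never comes back to it, hence never crosses [e],
whereas one that leaves it through [e] crosses [e] exactly once. *)
Lemma no_simultaneous_explosion : {ae P, forall w, (forall e, 0 < X e w) ->
  forall r e e' t, e != e' ->
    cheap (X ^~ w) (rcons r e) t -> cheap (X ^~ w) (rcons r e') t ->
    exists2 t', t' < t &
      cheap (X ^~ w) (rcons r e) t' \/ cheap (X ^~ w) (rcons r e') t'}.
Proof.
have H (p : seq (edge d) * edge d * edge d) : {ae P, forall w,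
   (forall e, 0 < X e w) -> forall t, p.1.2 != p.2 ->
    cheap (X ^~ w) (rcons p.1.1 p.1.2) t -> cheap (X ^~ w) (rcons p.1.1 p.2) t ->
    exists2 t', t' < t & cheap (X ^~ w) (rcons p.1.1 p.1.2) t' \/
                         cheap (X ^~ w) (rcons p.1.1 p.2) t'}.
  case: p => -[r e] e' /=.
  have [ee|ee] := boolP (e != e'); last by apply: aeW.
  have [xe|nxe] := boolP (simple 0 (rcons r e)); last first.
    apply: aeW => w _ t _ /(_ 0%N)[s [/andP[ss /prefixP[s2 sE]] _ _]].
    by move: ss nxe; rewrite sE => /simple_catl ->.
  have enr : e \notin r.
    by have := simple_uniq xe; rewrite rcons_uniq => /andP[].
  have ie : incident (endp 0 r) e.
    by move: xe => /andP[]; rewrite -cats1 walk_cat /= => /and3P[].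
  pose S f s := simple 0 s && prefix (rcons r f) s.
  have S1 s : S e s -> uniq s /\ e \in s.
    move=> /andP[ss /prefixP[s2 sE]]; split; first exact: simple_uniq ss.
    by rewrite sE mem_cat mem_rcons mem_head.
  have S2 s : S e' s -> e \notin s.
    move=> /andP[ss /prefixP[s2 sE]]; rewrite sE cat_rcons in ss *.
    rewrite mem_cat (negPf enr) inE (negPf ee) /=; apply/negP => es2.
    have /= /andP[/andP[_ w2] /andP[+ _]] := simple_catr ss.
    by rewrite (walk_incident_trace w2 es2 ie).
  have := no_tie indepX (rate_gt0 e) (lawX e) S1 S2.
  apply: filterS => w Hw W0 t _ H1 H2; apply: Hw => // i; exact: ltW.
have := ae_forall_countable H; apply: filterS => w Hw W0 r e e' t.
exact: (Hw (r, e, e') W0 t).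
Qed.

End Typical.

Unset Implicit Arguments.

Theorem theorem1p8 (R : realType) (d : nat) (hd : (0 < d)%N)
    (A : set 'rV[R]_d) (hA : is_limit_shape A)
    (mu : 'rV[R]_d -> R) (hmu : is_norm mu) (hmuA : [set z | mu z <= 1] = A)
    (alpha : R) (halpha : 1 < alpha)
    (x0 : 'rV[R]_d) (hx0 : furthest A mu x0) :
  exists (nu : 'rV[R]_d -> R) (theta : R),
    [/\ is_norm nu, 0 < theta < pi &
      forall (disp : measure_display) (Omega : measurableType disp)
             (P : probability Omega R) (X : edge d -> {RV P >-> R}),
        weighted_fpp (fun z => nu z `^ alpha) X ->
        {ae P, forall w,
          let V := cluster_vertices (X ^~ w) (tau_infty (X ^~ w)) in
          let C := cone x0 theta in
          let mC := [set - z | z in C] in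
          finite_set (V `\` [set v | C (embed R v)]) \/
          finite_set (V `\` [set v | mC (embed R v)])}].
Proof.
have x0n0 : x0 != 0.
  by case: hx0 => + _; rewrite -hmuA; exact: boundary_neq0.
have [i0 Hi0] : exists i0, forall i, `|x0 0 i| <= `|x0 0 i0|.
  pose i1 : 'I_d := Ordinal hd.
  exists [arg max_(i > i1) `|x0 0 i|]%O.
  by case: arg_maxP => // i _ H j; exact: H.
have a0 : 0 < `|x0 0 i0|.
  rewrite lt_neqAle normr_ge0 andbT eq_sym; apply: contraNN x0n0 => /eqP H0.
  apply/eqP/rowP => i; rewrite mxE; apply/eqP; rewrite -normr_eq0 eq_le normr_ge0.
  by rewrite -H0 Hi0.
(* Rescaled so that the largest coordinate of [c] is [1] in absolute value. *)
pose c := `|x0 0 i0|^-1 *: x0.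
have c_le1 i : `|c 0 i| <= 1.
  by rewrite mxE normrM normfV normr_id mulrC ler_pdivrMr ?mul1r.
have c_i0 : `|c 0 i0| = 1.
  by rewrite mxE normrM normfV normr_id mulVf // gt_eqF.
pose tlo := @time_lo R d; pose thi := @time_hi R d.
have tlo0 : 0 < tlo by exact: time_lo_gt0.
have thi0 : 0 < thi by exact: time_hi_gt0.
pose rc := ray_const alpha thi.
have rc0 : 0 < rc by exact: ray_const_gt0.
have e40 : 0 < tlo / 8 * escape alpha 4.
  by apply: mulr_gt0; [rewrite divr_gt0|exact: escape_gt0].
(* From weight [2 ^ m * y] infinity must be closer than any point of weight [y]; this
   fixes [m]. The value of [delta] then makes long slow paths too expensive. *)
have [m [m2 Hm]] := escape_small halpha (divr_gt0 e40 rc0).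
pose K : R := 2 ^+ m.
have K0 : 0 < K by rewrite exprn_gt0.
have eK0 : 0 < escape alpha K by exact: escape_gt0.
have eh0 : 0 < escape alpha 2^-1 by apply: escape_gt0 => //; rewrite invr_gt0.
pose del := tlo * escape alpha K / (8 * K * (rc * escape alpha 2^-1)).
have den0 : 0 < 8 * K * (rc * escape alpha 2^-1).
  by apply: mulr_gt0; exact: mulr_gt0.
have del0 : 0 < del by apply: divr_gt0 => //; exact: mulr_gt0.
pose delta := Num.min (2^-1 : R) del.
have delta0 : 0 < delta by rewrite lt_min del0 invr_gt0 ltr0n.
have delta_le : delta <= 2^-1 by rewrite ge_min lexx.
have far_cheap : rc * escape alpha K < tlo / 8 * escape alpha 4.
  by rewrite escape2X // mulrC -ltr_pdivlMr.
have delta_small : rc * escape alpha 2^-1 < tlo / (4 * K * delta) * escape alpha K.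
  have dd : delta <= del by rewrite ge_min lexx orbT.
  rewrite [ltRHS]mulrAC ltr_pdivlMr ?mulr_gt0 //.
  move: dd; rewrite /del ler_pdivlMr // => dd.
  have p0 : 0 < tlo * escape alpha K by rewrite mulr_gt0.
  by lra.
pose M := (Num.truncn (2 / delta + 5)).+1.
have M_ge : 2 / delta + 5 <= M%:R by apply: ltW; exact: truncnS_gt.
exists (weight c delta), (angle x0 i0 delta); split.
- exact: is_norm_weight.
- exact: angle_range.
move=> disp Omega P X [indepX lawX].
pose rate (e : edge d) := weight c delta (midpoint R e) `^ alpha.
have rate0 e : 0 < rate e by rewrite powR_gt0 // weight_midpoint_gt0.
have ae1 := times_gt0 rate0 lawX.
have ae2 := linear_times hd indepX rate0 lawX M.
have ae3 := no_simultaneous_explosion indepX rate0 lawX.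
apply: filterS3 ae1 ae2 ae3 => w W0 /(_ W0)[nH linear] /(_ W0) notie.
cbv zeta; pose W := X ^~ w.
have lin' n v s : (nH <= n)%N -> (nrm1 v <= M * n)%N ->
    simple v s -> size s = n ->
    tlo * n%:R <= \sum_(e <- s) rate e * W e <= thi * n%:R by exact: linear.
have [tau tauE] := tau_infty_finite c_i0 delta0 delta_le halpha thi0 M_ge W0 lin'.
have [N0 slow] := slow_not_reached c_le1 c_i0 delta0 delta_le halpha tlo0 thi0 M_ge
  W0 lin' m2 far_cheap delta_small.
pose Cp : set 'rV[int]_d := [set v | delta * (nrm1 v)%:R < dot (embed R v) c].
pose Cm : set 'rV[int]_d := [set v | delta * (nrm1 v)%:R < - dot (embed R v) c].
pose N1 := maxn N0 (Num.truncn delta^-1).+1.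
have delta_nrm (v : 'rV[int]_d) : 0 <= delta * (nrm1 v)%:R.
  by rewrite mulr_ge0 // ltW.
have Cpm v : Cp v -> Cm v -> False.
  by rewrite /Cp /Cm /= => h1 h2; have := delta_nrm v; lra.
have far v : (N1 <= nrm1 v)%N -> 1 <= delta * (nrm1 v)%:R.
  rewrite geq_max => /andP[_ Nv]; rewrite mulrC -ler_pdivrMr // mul1r.
  by apply: ltW; apply: lt_le_trans (truncnS_gt _) _; rewrite ler_nat.
have Cadj v e : incident v e -> (N1 <= nrm1 v)%N ->
    ~ (Cm v /\ Cp (other e v)) /\ ~ (Cp v /\ Cm (other e v)).
  move=> ve /far f1; have := dot_other c_le1 ve; rewrite ler_norml => /andP[h1 h2].
  have := delta_nrm (other e v); rewrite /Cm /Cp /= => h3.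
  by split => -[h4 h5]; clear -f1 h1 h2 h3 h4 h5; lra.
have Vpm v : cluster_vertices W (tau_infty W) v -> (N1 <= nrm1 v)%N ->
    Cp v \/ Cm v.
  move=> Vv; rewrite geq_max => /andP[Nv _]; have := slow v Vv Nv.
  by rewrite ltr_normr => /orP[|]; [left|right].
have CpC : Cp `<=` [set v | cone x0 (angle x0 i0 delta) (embed R v)].
  by move=> v Hv /=; apply: in_cone => //; rewrite l1norm_embed.
have CmC : Cm `<=`
    [set v | [set - z | z in cone x0 (angle x0 i0 delta)] (embed R v)].
  move=> v Hv /=; exists (- embed R v); last by rewrite opprK.
  apply: in_cone => //; rewrite -scaleN1r l1normZ normrN1 mul1r l1norm_embed.
  by rewrite dotZ mulN1r.
have [f|f] := cluster_one_sided W0 tauE Cpm Cadj Vpm notie.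
  by left; apply: sub_finite_set f; apply: setDS.
by right; apply: sub_finite_set f; apply: setDS.
Qed.
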